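(* Let $1<p_1,\ldots,p_m,r,p<\infty$ satisfy $$m+\frac1p=\sum_{i=1}^m\frac1{p_i}+\frac mr.$$ Assume also that $$\frac1p<\frac1r\qquad\text{and}\qquad 1-\frac1r<\frac1{p_i},\quad i=1,\ldots,m.$$ Let $0<q_1,\ldots,q_m,s\leq\infty$, and define $0<q\leq\infty$ by $$\frac1q=\sum_{i=1}^m\frac1{q_i}+\frac1s.$$ Then there exists a positive constant $C=C(n,m,p_1,\ldots,p_m,r,q_1,\ldots,q_m,s)$ such that $$\big\|T^K(f_1,\ldots,f_m)\big\|_{p,q}\leq C\Big(\prod_{i=1}^m\|f_i\|_{p_i,q_i}\Big)\|K\|_{r,s}$$ for all $f_i\in L^{p_i,q_i}(\mathbb{R}^n)$, $i=1,\ldots,m$, and all $K\in L^{r,s}((\mathbb{R}^n)^m)$.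
   Context: Here $n,m$ are positive integers and $1/\infty=0$. For a measurable function $f$ on a Euclidean space, $f^*(t)=\inf\{\lambda\ge 0: |\{|f|>\lambda\}|\le t\}$ is its decreasing rearrangement. For $0<p<\infty$, set $\|f\|_{p,q}=\left(\int_0^\infty (t^{1/p}f^*(t))^q\,\frac{dt}{t}\right)^{1/q}$ if $0<q<\infty$ and $\|f\|_{p,\infty}=\sup_{t>0}t^{1/p}f^*(t)$. The Lorentz space $L^{p,q}$ consists of all measurable $f$ with $\|f\|_{p,q}<\infty$. For a measurable function $K$ on $(\mathbb{R}^n)^m$ and measurable functions $f_1,\ldots,f_m$ on $\mathbb{R}^n$, the full-dimensional multilinear convolution operator is $$T^K(f_1,\ldots,f_m)(x)=\int_{(\mathbb{R}^n)^m}\Big(\prod_{i=1}^m f_i(x-y_i)\Big)K(y_1,\ldots,y_m)\,dy_1\cdots dy_m,$$ defined at those $x$ where the integral converges absolutely. For nonnegative functions it is well defined with values in $[0,\infty]$. Since $|T^K(f_1,\ldots,f_m)|\le T^{|K|}(|f_1|,\ldots,|f_m|)$, one uses the standard reduction to nonnegative functions and kernels. *)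

(* Defs.v *)
From HB Require Import structures.
From mathcomp Require Import all_boot all_order all_algebra.
From mathcomp Require Import all_classical all_reals all_analysis.
From mathcomp Require Import complex.

Set Implicit Arguments.
Unset Strict Implicit.
Unset Printing Implicit Defensive.

Import Order.TTheory GRing.Theory Num.Theory.
Import numFieldNormedType.Exports.

Local Open Scope classical_set_scope.
Local Open Scope ring_scope.

Section cons_measure.
Context d (T : measurableType d) (R : realType).
Variables (mu : {sigma_finite_measure set T -> \bar R}) (n : nat).
Variable nu : {sigma_finite_measure set (n.-tuple T) -> \bar R}.

Let tcons (xt : T * n.-tuple T) : n.+1.-tuple T := [tuple of xt.1 :: xt.2].

Let mtcons : measurable_fun [set: T * n.-tuple T] tcons.
Proof. exact: measurable_cons. Qed.

Let tuncons (t : n.+1.-tuple T) : T * n.-tuple T :=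
  (thead t, [tuple of behead t]).

Let mtuncons : measurable_fun [set: n.+1.-tuple T] tuncons.
Proof.
apply/measurable_fun_pairP; split; last exact: measurable_behead.
exact: (@measurable_tnth _ T n.+1 ord0).
Qed.

Let tconsK : cancel tcons tuncons.
Proof.
by move=> [x t]; rewrite /tuncons theadE; congr pair; exact: val_inj.
Qed.

Definition cons_measure : set (n.+1.-tuple T) -> \bar R :=
  pushforward (mu \x nu)%E tcons.

Let cons_measure0 : cons_measure set0 = 0%E.
Proof. exact: measure0. Qed.

Let cons_measure_ge0 A : (0 <= cons_measure A)%E.
Proof. exact: measure_ge0. Qed.

Let cons_measure_sigma_additive : semi_sigma_additive cons_measure.
Proof. exact: measure_semi_sigma_additive. Qed.

HB.instance Definition _ := isMeasure.Build _ _ _ cons_measure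
  cons_measure0 cons_measure_ge0 cons_measure_sigma_additive.

Let cons_measure_sigma_finite : sigma_finite setT cons_measure.
Proof.
have /sigma_finiteP[F [FT ndF Foo]] := sigma_finiteT mu.
have /sigma_finiteP[G [GT ndG Goo]] := sigma_finiteT nu.
exists (fun k => tuncons @^-1` (F k `*` G k)) => [|k].
  rewrite -preimage_bigcup (_ : \bigcup_k _ = setT) ?preimage_setT//.
  rewrite -setXTT FT GT; apply/seteqP; split.
    by move=> [x t] [k _ [Fx Gt]]; split; exists k.
  move=> [x t] [[k _ Fx] [l _ Gt]]; exists (maxn k l) => //; split.
  - by move/subsetPset: (ndF _ _ (leq_maxl k l)); apply.
  - by move/subsetPset: (ndG _ _ (leq_maxr k l)); apply.
have [[mF Fk] [mG Gk]] := (Foo k, Goo k); split.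
  rewrite -[X in measurable X]setTI.
  by apply: mtuncons => //; exact: measurableX.
rewrite /cons_measure /pushforward -comp_preimage (_ : _ \o _ = id).
  by rewrite preimage_id product_measure1E// lte_mul_pinfty// ge0_fin_numE.
by apply/funext => xt; exact: tconsK.
Qed.

HB.instance Definition _ := Measure_isSigmaFinite.Build _ _ _ cons_measure
  cons_measure_sigma_finite.

End cons_measure.

(* The n-fold product of mu, on the product sigma-algebra of n.-tuple T. *)
Fixpoint tuple_measure d (T : measurableType d) (R : realType)
    (mu : {sigma_finite_measure set T -> \bar R}) (n : nat) :
    {sigma_finite_measure set (n.-tuple T) -> \bar R} :=
  match n with
  | 0 => \d_([tuple] : 0.-tuple T)
  | n'.+1 => cons_measure mu (tuple_measure mu n')
  end.

Lemma tuple_measure_box d (T : measurableType d) (R : realType)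
    (mu : {sigma_finite_measure set T -> \bar R}) (n : nat)
    (A : 'I_n -> set T) : (forall i, measurable (A i)) ->
  tuple_measure mu n [set t | forall i, A i (tnth t i)] =
  (\prod_(i < n) mu (A i))%E.
Proof.
elim: n A => [A _|n IH A mA]/=.
  rewrite big_ord0 diracE mem_set//; by case.
rewrite big_ord_recl -IH//.
rewrite /cons_measure /pushforward.
set B := [set t | forall i, A (lift ord0 i) (tnth t i)].
rewrite (_ : _ @^-1` _ = A ord0 `*` B).
  rewrite product_measure1E//.
  rewrite (_ : B = \big[setI/setT]_(i < n)
    ((@tnth _ T ^~ i) @^-1` A (lift ord0 i))).
    apply: bigsetI_measurable => i _; rewrite -[X in measurable X]setTI.
    exact: measurable_tnth.
  rewrite -bigcap_seq; apply/seteqP; split=> t /= Bt => [i _|i].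
    exact: Bt.
  by apply: Bt; rewrite /= mem_index_enum.
apply/seteqP; split=> [[x t]/= xt|[x t]/= [Ax Bt] i].
  split; first exact: (xt ord0).
  by move=> i; have := xt (lift ord0 i); rewrite tnthS.
by case: (unliftP ord0 i) => [j|] ->//; rewrite tnthS; exact: Bt.
Qed.

Section euclidean_spaces.
Variables (R : realType) (n : nat).

Definition borel_leb := tuple_measure (@lebesgue_measure R) n.

Definition borel_leb_pow (m : nat) := tuple_measure borel_leb m.

(* R^n and (R^n)^m with their Lebesgue measurable sets and Lebesgue measure,
   i.e., the completion of the Borel product measure. The underlying types are
   n.-tuple R and m.-tuple (n.-tuple R). *)
Definition Rn := caratheodory_type (borel_leb^*)%mu.

Definition Rnm (m : nat) := caratheodory_type ((borel_leb_pow m)^*)%mu.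

HB.instance Definition _ := Measurable.on Rn.
HB.instance Definition _ m := Measurable.on (Rnm m).

Definition leb : {measure set Rn -> \bar R} :=
  @completed_measure_extension _ _ _ borel_leb.

Definition leb_pow (m : nat) : {measure set (Rnm m) -> \bar R} :=
  @completed_measure_extension _ _ _ (borel_leb_pow m).

Definition subRn (x y : Rn) : Rn :=
  [tuple (tnth x j : R) - tnth y j | j < n].

End euclidean_spaces.

Definition cabs (R : realType) (z : R[i]) : R := ComplexField.Normc.normc z.

Section complex_valued.
Context d (T : measurableType d) (R : realType).
Variable mu : {measure set T -> \bar R}.
Implicit Type f : T -> R[i].

Definition cmeasurable f :=
  measurable_fun [set: T] (fun x => complex.Re (f x)) /\
  measurable_fun [set: T] (fun x => complex.Im (f x)).

Definition abs_convergent f :=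
  (\int[mu]_x (cabs (f x))%:E < +oo)%E.

Definition cintegral f : R[i] :=
  (\int[mu]_x complex.Re (f x) +i* \int[mu]_x complex.Im (f x))%C.

End complex_valued.

Section lorentz.
Context d (T : measurableType d) (R : realType).
Variable mu : {measure set T -> \bar R}.
Implicit Type f : T -> R[i].
Local Open Scope ereal_scope.

Definition rearrangement f (t : R) : \bar R :=
  ereal_inf [set l%:E | l in
    [set l : R | (0 <= l)%R /\ mu [set x | (l < cabs (f x))%R] <= t%:E]].

(* The value at q = -oo is irrelevant: only exponents 0 < q are used. *)
Definition lorentz_norm (p : R) (q : \bar R) f : \bar R :=
  match q with
  | q'%:E => (\int[lebesgue_measure]_(t in `]0%R, +oo[)
      (((t `^ p^-1)%:E * rearrangement f t) `^ q' * (t^-1)%:E)) `^ q'^-1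
  | +oo => ereal_sup
      [set (t `^ p^-1)%:E * rearrangement f t | t in [set t : R | (0 < t)%R]]
  | -oo => 0
  end.

Definition lorentz_space (p : R) (q : \bar R) : set (T -> R[i]) :=
  [set f | cmeasurable f /\ lorentz_norm p q f < +oo].

End lorentz.

Section multilinear_convolution.
Context (R : realType) (n m : nat).
Variables (f : 'I_m -> Rn R n -> R[i]) (K : Rnm R n m -> R[i]).

Definition conv_integrand (x : Rn R n) (y : Rnm R n m) : R[i] :=
  (\prod_(i < m) f i (subRn x (tnth y i))) * K y.

Definition conv_defined (x : Rn R n) : Prop :=
  abs_convergent (leb_pow R n m) (conv_integrand x).

(* Extended by 0 to the points where the integral does not converge
   absolutely. *)
Definition multilinear_conv (x : Rn R n) : R[i] :=
  if `[< conv_defined x >]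
  then cintegral (leb_pow R n m) (conv_integrand x) else 0.

End multilinear_convolution.

(* Main.v *)
Require Import Defs.
From HB Require Import structures.
From mathcomp Require Import all_boot all_order all_algebra.
From mathcomp Require Import all_classical all_reals all_analysis.
From mathcomp Require Import complex.
From mathcomp Require Import measurable_realfun.
From mathcomp Require Import ring lra.

Set Implicit Arguments.
Unset Strict Implicit.
Unset Printing Implicit Defensive.

Import Order.TTheory GRing.Theory Num.Theory.
Import numFieldNormedType.Exports.

Local Open Scope classical_set_scope.
Local Open Scope ring_scope.

(** The theorem is a multilinear interpolation between trivial estimates for the
    nonnegative form: integrating the product of the [f_i (x - y_i)] over [y] gives
    the product of the [L^1] norms of the [f_i] (kernel in [L^oo]); integrating [K]
    over [y] is the case where all the [f_i] are in [L^oo]; and integrating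
    [f_j (x - y_j) * K y] over [x] and [y] is the case where [f_j] and [K] are in
    [L^1] and the other functions in [L^oo].  In the coordinates
    [(1/p_1, ..., 1/p_m, 1/r)] these are the points [(1, ..., 1, 0)],
    [(0, ..., 0, 1)] and [(e_j, 1)].  The given exponents have barycentric
    coordinates [1 - 1/r], [1/r - 1/p] and [1/p_j + 1/r - 1], which the
    hypotheses make positive: the point is in the interior of the simplex, and
    stays there when every coordinate is moved by some small [eta] in either
    direction ([exponent_margin]).

    This room is used pointwise.  Put [phi_u x = min (x^(1/(u-eta)), x^(1/(u+eta)))].
    Choosing for each number the sign for which [phi_u x] is a pure power and
    writing the product in barycentric form gives [two_power_mixing]:
    [prod x_i * z <= prod phi x_i + phi z + sum_j phi x_j * phi z].
    Apply it to [x_i = f_i (x - y_i) / a_i] and [z = K y / b] and integrate over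
    [y]: the first two terms are bounded uniformly in [x], the last one is bounded
    in [L^1], and Chebyshev's inequality gives the estimate at scale [t],
    [nnconv_weak]: if [int phi (f_i / a_i) <= C t] and [int phi (K / b) <= C t^m]
    then [c * prod a_i * b * t^m] bounds the rearrangement of the convolution
    at [t].

    The function [phi], unlike a pure power, only asks of [f^*] a power decay away
    from the scale [t].  The constant [a] needed for this at scale [t] is, up to a
    fixed factor, [N * X t ^ (1/q) * t ^ (-1/p)], where [N] is the Lorentz norm of
    [f] and [X] has a bounded integral for [dt/t]: for finite [q] one takes for [X]
    the average of [(v^(1/p) f^*(v))^q] in the multiplicative group against a bump
    function, see [lorentz_profile].  Hence [t^(1/p) T^*(t)] is at most a constant times the
    norms times [prod X_i^(1/q_i) * Y^(1/s)], and since [1/q] is the sum of the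
    [1/q_i] and [1/s], the [q]-th power of that product is at most
    [sum X_i + Y] ([prod_powR_le]), whose integral is bounded
    ([lorentz_norm_le]).

    Lebesgue measurable data are first replaced by Borel ones equal to them off
    null sets, so that Tonelli's theorem and the invariance of the iterated product
    measure apply. *)

(** * A pointwise inequality between a product and a sum *)

Definition two_power (R : realType) (u eta x : R) : R :=
  Num.min (x `^ (u - eta)^-1) (x `^ (u + eta)^-1).

Lemma two_power_ge0 (R : realType) (u eta x : R) : 0 <= two_power u eta x.
Proof. by rewrite /two_power le_min !powR_ge0. Qed.

(** Every nonnegative number is a pure power of its image, the exponent being one of
    two: this is how the sign of the perturbation is chosen for each factor. *)
Lemma two_powerK (R : realType) (u eta x : R) : 0 < eta < u -> 0 <= x ->
  exists2 u', u' = u - eta \/ u' = u + eta & two_power u eta x `^ u' = x.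
Proof.
move=> /andP[eta0 etau] x0.
have k0 : 0 < u - eta by rewrite subr_gt0.
have l0 : 0 < u + eta by rewrite addr_gt0// (lt_trans eta0).
rewrite /two_power minElt; case: ifPn => _.
  by exists (u - eta); [left|rewrite -powRrM mulVf ?gt_eqF// powRr1].
by exists (u + eta); [right|rewrite -powRrM mulVf ?gt_eqF// powRr1].
Qed.

Lemma prod_powR (R : realType) (I : finType) (a : I -> R) (s : R) :
  (forall i, 0 <= a i) -> (\prod_i a i) `^ s = \prod_i a i `^ s.
Proof.
move=> a0.
suff [] : (\prod_i a i) `^ s = \prod_i a i `^ s /\ 0 <= \prod_i a i by [].
elim/big_rec2 : _ => [|i x y _ [<- y0]]; first by rewrite powR1.
by rewrite powRM// mulr_ge0.
Qed.

Lemma powRD_nneg (R : realType) (a r s : R) : 0 <= r -> 0 <= s ->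
  a `^ (r + s) = a `^ r * a `^ s.
Proof.
move=> r0 s0; have [->|a0] := eqVneq a 0; last by rewrite powRD// a0 implybT.
have [->|rn0] := eqVneq r 0; first by rewrite add0r powRr0 mul1r.
rewrite (powR0 rn0) mul0r powR0// gt_eqF// ltr_pwDl//.
by rewrite lt_neqAle eq_sym rn0.
Qed.

Lemma powR_sum (R : realType) (I : finType) (a : R) (s : I -> R) :
  (forall i, 0 <= s i) -> a `^ (\sum_i s i) = \prod_i a `^ s i.
Proof.
move=> s0.
suff [] : a `^ (\sum_i s i) = \prod_i a `^ s i /\ 0 <= \sum_i s i by [].
elim/big_rec2 : _ => [|i y x _ [<- x0]]; first by rewrite powRr0.
by rewrite powRD_nneg// addr_ge0.
Qed.

(** With the exponents [u'] and [v'] of [two_powerK], the left-hand side is a product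
    of the three kinds of terms on the right raised to the barycentric coordinates
    [1 - v'], [v' - sum (u'_i + v' - 1)] and [u'_j + v' - 1].  These are nonnegative
    by the margin [eta], and add up to [1]; each term is at most the sum [M] of all
    of them, so that the product is at most [M]. *)
Lemma two_power_mixing (R : realType) (m : nat) (u : 'I_m -> R) (v eta : R) :
  0 < eta < v -> v + eta <= 1 -> (forall i, eta *+ 2 <= u i + v - 1) ->
  eta *+ (m.*2.+1) <= v - \sum_(i < m) (u i + v - 1) ->
  forall (x : 'I_m -> R) (z : R), (forall i, 0 <= x i) -> 0 <= z ->
  (\prod_(i < m) x i) * z <=
  \prod_(i < m) two_power (u i) eta (x i) + two_power v eta z +
  \sum_(i < m) two_power (u i) eta (x i) * two_power v eta z.
Proof.
move=> vI hv hu hs x z x0 z0; have /andP[eta0 _] := vI.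
have v0 : 0 < v by case/andP: vI => ? ?; lra.
have uI i : 0 < eta < u i.
  have := hu i; rewrite eta0/= mulr2n; lra.
have [v' v'E zE] := two_powerK vI z0.
set b := two_power v eta z in zE *.
have /choice[u' u'P] : forall i, exists w,
    (w = u i - eta \/ w = u i + eta) /\ two_power (u i) eta (x i) `^ w = x i.
  by move=> i; have [w wE xE] := two_powerK (uI i) (x0 i); exists w.
have u'E i := (u'P i).1; have xE i := (u'P i).2.
set a := fun i => two_power (u i) eta (x i) in xE *.
have a0 i : 0 <= a i by exact: two_power_ge0.
have b0 : 0 <= b by exact: two_power_ge0.
pose g i := u' i + v' - 1.
have g0 i : 0 <= g i.
  have := hu i; rewrite mulr2n /g.
  by case: (u'E i) => ->; case: v'E => ->; lra.
have al0 : 0 <= 1 - v' by case: v'E => ->; lra.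
have be0 : 0 <= v' - \sum_i g i.
  have gle : \sum_i g i <= \sum_i (u i + v - 1) + eta *+ m.*2.
    rewrite -mul2n mulrnA -[X in _ *+ X]card_ord -sumr_const -big_split/=.
    apply: ler_sum => i _; rewrite /g mulr2n.
    by case: (u'E i) => ->; case: v'E => ->; lra.
  by move: hs; rewrite mulrS; case: v'E => ->; lra.
set M := \prod_i a i + b + \sum_i a i * b.
have S0 : 0 <= \sum_i a i * b by apply: sumr_ge0 => i _; exact: mulr_ge0.
have P0 : 0 <= \prod_i a i by exact: prodr_ge0.
have M0 : 0 <= M by rewrite !addr_ge0.
have PM : \prod_i a i <= M by rewrite /M; lra.
have bM : b <= M by rewrite /M; lra.
have abM i : a i * b <= M.
  have : a i * b <= \sum_i a i * b.
    by rewrite (bigD1 i)//= lerDl sumr_ge0// => j _; exact: mulr_ge0.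
  by rewrite /M; lra.
(* the barycentric form of the product *)
have -> : (\prod_i x i) * z =
    (\prod_i a i) `^ (1 - v') * b `^ (v' - \sum_i g i) *
    \prod_i (a i * b) `^ g i.
  rewrite prod_powR//.
  rewrite [X in _ = _ * X](eq_bigr (fun i => a i `^ g i * b `^ g i)); last first.
    by move=> i _; rewrite powRM.
  rewrite [X in _ = _ * X]big_split/= mulrACA -big_split/= -powR_sum//; congr (_ * _).
    apply: eq_bigr => i _; rewrite -xE//.
    by rewrite -powRD_nneg//; congr (_ `^ _); rewrite /g; ring.
  by rewrite -zE -powRD_nneg ?sumr_ge0// subrK.
have ME : M `^ (1 - v') * M `^ (v' - \sum_i g i) * \prod_i M `^ g i = M.
  rewrite -powR_sum// -powRD_nneg// -powRD_nneg ?(addr_ge0 al0)// ?sumr_ge0//.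
  by rewrite addrA !subrK powRr1.
rewrite -[leRHS]ME ler_pM ?mulr_ge0 ?powR_ge0//.
- by apply: prodr_ge0 => i _; exact: powR_ge0.
- by apply: ler_pM; rewrite ?powR_ge0// ge0_ler_powR// nnegrE.
- apply: ler_prod => i _; rewrite powR_ge0/= ge0_ler_powR// ?nnegrE//.
  exact: mulr_ge0.
Qed.

(** * A bump function on the multiplicative half-line *)

(** As a function of [ln (a / b)] this is the density of the logistic distribution:
    it decays exponentially on both sides, and has an explicit primitive. *)
Definition logistic (R : realType) (a b : R) : R := a * b / (a + b) ^+ 2.

Lemma powR_cvgy (R : realType) (k : R) : 0 < k ->
  t `^ k @[t --> +oo] --> +oo.
Proof.
move=> k0; apply/cvgryPge => M; near=> t.
have M0 : 0 <= Num.max M 0 by rewrite le_max lexx orbT.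
apply: (@le_trans _ _ (Num.max M 0)); first by rewrite le_max lexx.
rewrite -[leLHS]powRr1// -(@mulVf _ k) ?gt_eqF// powRrM ge0_ler_powR ?nnegrE ?powR_ge0 ?ltW//.
Unshelve. all: by end_near. Qed.

(** The factor [1 / t] turns [dt] into the invariant measure of the multiplicative
    group; the primitive is then a rational function of [t ^ k]. *)
Lemma derive_logistic (R : realType) (k c t : R) : 0 < k -> 0 < c -> 0 < t ->
  is_derive t 1 (fun t => - (k^-1 * c) * (t `^ k + c)^-1)
    (logistic (t `^ k) c / t).
Proof.
move=> k0 c0 t0.
have h : t `^ k + c != 0 by rewrite gt_eqF// ltr_wpDl// powR_ge0.
have h1 := is_derive1_powR k t0.
have h2 := is_deriveD h1 (is_derive_cst c t 1).
have h3 := is_deriveV (f := (powR (R:=R))^~ k + cst c) h h2.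
have h4 := is_deriveZ (- (k^-1 * c)) h3.
apply: is_derive_eq h4 _.
have tE : t `^ (k - 1) = t `^ k / t.
  by rewrite powRB ?(gt_eqF t0) ?implybT// powRr1// ltW.
rewrite /logistic addr0 /GRing.scale/= tE.
rewrite -[((powR (R:=R))^~ k + cst c) t]/(t `^ k + c).
by field; rewrite h !gt_eqF.
Qed.

Lemma logistic_ge0 (R : realType) (a b : R) : 0 <= a -> 0 <= b -> 0 <= logistic a b.
Proof. by move=> a0 b0; rewrite /logistic divr_ge0 ?mulr_ge0 ?exprn_ge0 ?addr_ge0. Qed.

Lemma logistic_le1 (R : realType) (a b : R) : 0 <= a -> 0 <= b -> logistic a b <= 1.
Proof.
move=> a0 b0; have [->|an] := eqVneq a 0; first by rewrite /logistic !mul0r.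
have ap : 0 < a by rewrite lt_neqAle eq_sym an.
rewrite /logistic ler_pdivrMr ?exprn_gt0 ?ltr_pwDl// mul1r.
have := sqr_ge0 a; have := sqr_ge0 b; have := mulr_ge0 a0 b0.
rewrite sqrrD; lra.
Qed.

Lemma integral_logistic_ray (R : realType) (k c a : R) : 0 < k -> 0 < c -> 0 < a ->
  (\int[lebesgue_measure]_(t in `[a, +oo[) (logistic (t `^ k) c / t)%:E <= k^-1%:E)%E.
Proof.
move=> k0 c0 a0.
have D t : a <= t -> is_derive t (1 : R^o) (fun t => - (k^-1 * c) * (t `^ k + c)^-1 : R^o)
    (logistic (t `^ k) c / t : R^o).
  by move=> ?; apply: derive_logistic => //; exact: lt_le_trans a0 _.
have pos t : 0 < t `^ k + c by rewrite ltr_wpDl// powR_ge0.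
rewrite (ge0_continuous_FTC2y (F := fun t => - (k^-1 * c) * (t `^ k + c)^-1)
  (l := 0)).
- rewrite -EFinB lee_fin sub0r mulNr opprK -mulrA ler_piMr ?invr_ge0 ?(ltW k0)//.
  by rewrite ler_pdivrMr// mul1r lerDr powR_ge0.
- by move=> t at'; rewrite divr_ge0 ?logistic_ge0 ?powR_ge0 ?ltW// (lt_le_trans a0).
- apply: continuous_in_subspaceT => t; rewrite inE/= in_itv/= andbT => at'.
  have t0 : 0 < t by exact: lt_le_trans at'.
  have ct : {for t, continuous (powR (R:=R) ^~ k : R -> R)}.
    have [/derivable1_diffP + _] := is_derive1_powR k t0.
    exact: differentiable_continuous.
  apply: cvgM; last by apply: cvgV; [rewrite gt_eqF|exact: cvg_id].
  apply: cvgM; first by apply: cvgM; [exact: ct|exact: cvg_cst].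
  apply: cvgV; first by rewrite expf_eq0 /= gt_eqF// pos.
  by apply: cvgM; apply: cvgD; [exact: ct|exact: cvg_cst|exact: ct|exact: cvg_cst].
- rewrite -[X in _ --> X](mulr0 (- (k^-1 * c))); apply: cvgMl_tmp.
  apply/gtr0_cvgV0; first by near=> t; exact: pos.
  have := powR_cvgy k0; move=> /cvgryPge h; apply/cvgryPge => M.
  by near=> t; rewrite ler_wpDr ?(ltW c0)//; near: t; exact: h.
- by move=> t at'; have [] := D t (ltW at').
- apply: cvg_at_right_filter.
  by have [/derivable1_diffP/differentiable_continuous] := D a (lexx a).
- by move=> t; rewrite in_itv/= andbT => at'; rewrite derive1E; have [_ ->] := D t (ltW at').
Unshelve. all: by end_near.
Qed.

Lemma itv0y_bigcup (R : realType) :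
  `]0%R, +oo[%classic = \bigcup_n `[(n.+1%:R : R)^-1, +oo[%classic.
Proof.
apply/seteqP; split=> t /=; last first.
  by move=> [n _]; rewrite /= !in_itv/= !andbT; apply: lt_le_trans; rewrite invr_gt0.
rewrite in_itv/= andbT => t0.
have tn : t^-1 < (Num.bound t^-1)%:R by rewrite archi_boundP// invr_ge0 ltW.
exists (Num.bound t^-1) => //=; rewrite in_itv/= andbT invf_ple ?posrE//.
by apply: (le_trans (ltW tn)); rewrite ler_nat.
Qed.

Lemma measurable_funV_nneg (R : realType) d (T : measurableType d) (D : set T)
    (f : T -> R) : measurable_fun D f -> (forall x, D x -> 0 <= f x) ->
  measurable_fun D (fun x => (f x)^-1).
Proof.
move=> mf f0; apply: (eq_measurable_fun (fun x => f x `^ (-1))) => [x|].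
  by rewrite inE => Dx; rewrite powR_inv1// f0.
exact: (measurableT_comp (measurable_powR _) mf).
Qed.

Lemma itv0y_gt0 (R : realType) (t : R) : `]0%R, +oo[%classic t -> 0 < t.
Proof. by rewrite /= in_itv/= andbT. Qed.

Lemma measurable_inv_itv0y (R : realType) :
  measurable_fun (`]0%R, +oo[%classic : set (measurableTypeR R))
    (fun t : measurableTypeR R => t^-1).
Proof. by apply: measurable_funV_nneg => // t /itv0y_gt0/ltW. Qed.

Lemma measurable_logistic (R : realType) d (T : measurableType d) (D : set T)
    (f g : T -> R) : measurable D -> measurable_fun D f -> measurable_fun D g ->
  (forall x, D x -> 0 <= f x + g x) ->
  measurable_fun D (fun x => logistic (f x) (g x)).
Proof.
move=> mD mf mg fg0.
apply: measurable_funM; first exact: measurable_funM.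
apply: measurable_funV_nneg; last by move=> x Dx; rewrite exprn_ge0 ?fg0.
by apply: measurable_funX; exact: measurable_funD.
Qed.

Lemma integral_logistic (R : realType) (k c : R) : 0 < k -> 0 < c ->
  (\int[lebesgue_measure]_(t in `]0%R, +oo[) (logistic (t `^ k) c / t)%:E <= k^-1%:E)%E.
Proof.
move=> k0 c0; rewrite itv0y_bigcup.
have f0 i t : `[i.+1%:R^-1, +oo[%classic t -> (0 <= (logistic (t `^ k) c / t)%:E)%E.
  rewrite /= in_itv/= andbT => it; have t0 : 0 < t.
    by apply: lt_le_trans it; rewrite invr_gt0.
  by rewrite lee_fin divr_ge0 ?logistic_ge0 ?powR_ge0 ?ltW.
have mf i : measurable_fun (`[i.+1%:R^-1, +oo[%classic : set (measurableTypeR R))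
    (fun t => (logistic (t `^ k) c / t)%:E).
  apply/measurable_EFinP/measurable_funM; last first.
    apply: measurable_funV_nneg => // t.
    by rewrite /= in_itv/= andbT; apply: le_trans; rewrite invr_ge0.
  apply: measurable_logistic => //.
    by apply: measurable_funTS; exact: measurable_powR.
  by move=> t _; rewrite addr_ge0 ?powR_ge0 ?ltW.
have cv := @ge0_nondecreasing_set_cvg_integral _ (measurableTypeR R) R
  (fun i => `[(i.+1%:R : R)^-1, +oo[%classic)
  (fun t => (logistic (t `^ k) c / t)%:E) lebesgue_measure _ _ mf f0.
have mD i : measurable (`[i.+1%:R^-1, +oo[%classic : set (measurableTypeR R)).
  exact: measurable_itv.
have ndD : nondecreasing_seq (fun i => `[(i.+1%:R : R)^-1, +oo[%classic).
  move=> i j ij; rewrite subsetEset => t; rewrite /= !in_itv/= !andbT.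
  by apply: le_trans; rewrite lef_pV2 ?posrE// ler_nat.
rewrite -(cvg_lim _ (cv ndD mD))//.
apply: lime_le; first by apply: cvgP; exact: (cv ndD mD).
by apply: nearW => i; apply: integral_logistic_ray.
Qed.

(** Writing the weight as [1 / max (t, 0)], which vanishes for [t <= 0], turns
    integrals over the half-line into integrals over the whole line, to which
    Tonelli's theorem applies directly. *)
Lemma integral_itv0y (R : realType) (g : R -> \bar R) :
  (\int[lebesgue_measure]_(t in `]0%R, +oo[) (g t * (t^-1)%:E) =
   \int[lebesgue_measure]_t (g t * ((Num.max t 0)^-1)%:E))%E.
Proof.
rewrite integral_mkcond; apply: eq_integral => t _.
rewrite patchE mem_setE in_itv/= andbT; case: ifPn => t0.
  by rewrite max_l// ltW.
by rewrite max_r ?leNgt// invr0 mule0.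
Qed.

Lemma measurable_invmax0 (R : realType) :
  measurable_fun setT (fun t : R => (Num.max t 0)^-1).
Proof.
apply: measurable_funV_nneg; last by move=> t _; rewrite le_max lexx orbT.
exact: measurable_maxr.
Qed.

Lemma invmax0_ge0 (R : realType) (t : R) : 0 <= (Num.max t 0)^-1.
Proof. by rewrite invr_ge0 le_max lexx orbT. Qed.

(** Averaging against the bump preserves integrability for [dt/t], by Tonelli's
    theorem; the exponents [k] and [l] allow for a comparison of [v] with a power
    of [t]. *)
Lemma integral_logistic_average (R : realType) (k l : R)
    (H : measurableTypeR R -> \bar R) :
  0 < k -> 0 < l -> measurable_fun setT H -> (forall v, 0 <= H v)%E ->
  (forall v, v <= 0 -> H v = 0%E) ->
  let X := fun t : measurableTypeR R =>
    (\int[lebesgue_measure]_v (H v * (logistic (t `^ l) (v `^ k))%:E))%E in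
  measurable_fun setT X /\
  (\int[lebesgue_measure]_(t in `]0%R, +oo[) (X t * (t^-1)%:E)
   <= l^-1%:E * \int[lebesgue_measure]_v H v)%E.
Proof.
move=> k0 l0 mH H0 Hneg X.
have mK : measurable_fun setT (fun tv : measurableTypeR R * measurableTypeR R =>
    (H tv.2 * (logistic (tv.1 `^ l) (tv.2 `^ k))%:E)%E).
  apply: emeasurable_funM; first exact: measurableT_comp.
  apply/measurable_EFinP; apply: measurable_logistic => //.
  - exact: (measurableT_comp (measurable_powR _)).
  - exact: (measurableT_comp (measurable_powR _)).
  - by move=> x _; rewrite addr_ge0 ?powR_ge0.
have K0 (t v : R) : (0 <= H v * (logistic (t `^ l) (v `^ k))%:E)%E.
  by rewrite mule_ge0// lee_fin logistic_ge0 ?powR_ge0.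
have mX : measurable_fun setT X.
  apply: (measurable_fun_fubini_tonelli_F (m2 := @lebesgue_measure R) _ mK) => -[t v].
  exact: K0.
split; first exact: mX.
have mw : measurable_fun setT (fun t : measurableTypeR R => ((Num.max t 0)^-1)%:E).
  by apply/measurable_EFinP; exact: measurable_invmax0.
rewrite integral_itv0y.
pose f (tv : measurableTypeR R * measurableTypeR R) :=
  (H tv.2 * (logistic (tv.1 `^ l) (tv.2 `^ k))%:E *
  ((Num.max tv.1 0)^-1)%:E)%E : \bar R.
have mf : measurable_fun setT f.
  by apply: emeasurable_funM => //; exact: (measurableT_comp mw).
have f0 tv : (0 <= f tv)%E by rewrite mule_ge0// lee_fin invmax0_ge0.
rewrite (_ : (\int[_]_t _ =
    \int[lebesgue_measure]_t \int[lebesgue_measure]_v f (t, v))%E); last first.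
  apply: eq_integral => t _; rewrite -ge0_integralZr//.
    exact: (measurableT_comp mK (measurable_pair1 _)).
  by rewrite lee_fin invmax0_ge0.
rewrite (fubini_tonelli f mf f0)/= -ge0_integralZl//; last first.
  by rewrite lee_fin invr_ge0 ltW.
apply: ge0_le_integral => //.
- by move=> v _; apply: integral_ge0.
- exact: (measurable_fun_fubini_tonelli_G (m1 := @lebesgue_measure R) _ mf).
- exact: measurable_funeM.
move=> v _; rewrite /f/=.
have [v0|v0] := leP v 0.
  rewrite Hneg// mule0 integral0_eq// => t _; rewrite !mul0e//.
rewrite muleC.
under eq_integral do rewrite -muleA -EFinM.
rewrite ge0_integralZl//; last 2 first.
  apply/measurable_EFinP/measurable_funM; last exact: measurable_invmax0.
  apply: measurable_logistic => //.
  by move=> t _; rewrite addr_ge0 ?powR_ge0.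
  by move=> t _; rewrite lee_fin mulr_ge0 ?logistic_ge0 ?powR_ge0 ?invmax0_ge0.
apply: lee_wpmul2l => //.
under eq_integral do rewrite EFinM.
rewrite -integral_itv0y; under eq_integral do rewrite -EFinM.
by apply: integral_logistic => //; exact: powR_gt0.
Qed.

(** * Decreasing rearrangements *)

Lemma antitone_emeasurable (R : realType) (f : measurableTypeR R -> \bar R) :
  {homo f : x y / (x <= y)%R >-> (y <= x)%E} -> measurable_fun setT f.
Proof.
move=> hf; apply: (measurability _ (ErealGenCInfty.measurableE R)).
move=> /= _ [_ [a ->]] <-; rewrite setTI; apply: is_interval_measurable => s t/=.
rewrite !in_itv/= !andbT => fs ft w /andP[_ wt].
by rewrite in_itv/= andbT (le_trans ft)// hf.
Qed.

Lemma cabsE (R : realType) (z : R[i]) :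
  cabs z = Num.sqrt (complex.Re z ^+ 2 + complex.Im z ^+ 2).
Proof. by case: z. Qed.

Lemma cabs_ge0 (R : realType) (z : R[i]) : 0 <= cabs z.
Proof. by rewrite cabsE sqrtr_ge0. Qed.

Lemma measurable_cabs (R : realType) d (T : measurableType d) (f : T -> R[i]) :
  cmeasurable f -> measurable_fun setT (fun x => cabs (f x)).
Proof.
move=> [mr mi]; under eq_fun do rewrite cabsE.
have ms : measurable_fun setT (@Num.sqrt R).
  by apply: continuous_measurable_fun; exact: sqrt_continuous.
apply: (measurableT_comp ms).
by apply: measurable_funD; exact: measurable_funX.
Qed.

Section rearrangement_theory.
Context (R : realType) d (T : measurableType d) (mu : {measure set T -> \bar R}).
Variable f : T -> R[i].
Local Open Scope ereal_scope.

Lemma rearrangement_ge0 t : 0 <= rearrangement mu f t.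
Proof. by apply: le_ereal_inf_tmp => _ [l [l0 _] <-]; rewrite lee_fin. Qed.

Lemma rearrangement_anti :
  {homo rearrangement mu f : s t / (s <= t)%R >-> t <= s}.
Proof.
move=> s t st; apply: ereal_inf_le_tmp => _ [l [l0 lt] <-].
by exists l => //; split => //; apply: le_trans lt _; rewrite lee_fin.
Qed.

Lemma measurable_rearrangement : measurable_fun setT
  (rearrangement mu f : measurableTypeR R -> \bar R).
Proof. by apply: antitone_emeasurable => s t; exact: rearrangement_anti. Qed.

Lemma rearrangement_le l t : (0 <= l)%R ->
  mu [set x | (l < cabs (f x))%R] <= t%:E -> rearrangement mu f t <= l%:E.
Proof. by move=> l0 ml; apply: ereal_inf_lbound; exists l. Qed.

Lemma measure_gt_rearrangement l t : cmeasurable f ->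
  rearrangement mu f t < l%:E -> mu [set x | (l < cabs (f x))%R] <= t%:E.
Proof.
move=> mf /ereal_inf_lt[_ [l' [l'0 ml'] <-]]; rewrite lte_fin => ll'.
have mS (a : R) : measurable [set x | (a < cabs (f x))%R].
  have := measurable_cabs mf measurableT (measurable_itv `]a, +oo[).
  by rewrite setTI preimage_itvoy.
apply: le_trans ml'; apply: le_measure; rewrite ?inE//.
by move=> x /=; exact: lt_trans.
Qed.

End rearrangement_theory.

(** * Integrals of two-power functions *)

Lemma nneseries_geometric_le (R : realType) (c a : R) : 0 <= c -> 0 <= a < 1 ->
  (\sum_(k <oo) (c * a ^+ k)%:E <= (c / (1 - a))%:E)%E.
Proof.
move=> c0 /andP[a0 a1]; apply: lime_le.
  by apply: is_cvg_nneseries => k _ _; rewrite lee_fin mulr_ge0 ?exprn_ge0.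
apply: nearW => n; rewrite sumEFin lee_fin -mulr_sumr ler_wpM2l//.
rewrite big_mkord -[leRHS]mul1r ler_pdivlMr ?subr_gt0// mulrC.
rewrite -opprB mulNr -subrX1 opprB gerBl.
by rewrite exprn_ge0.
Qed.

Lemma dyadic_floor (R : realType) (g : R) : 1 <= g ->
  exists k, 2 ^+ k <= g < 2 ^+ k.+1.
Proof.
move=> g1; have [n gn] : exists n, g < 2 ^+ n.
  exists (Num.bound g); apply: lt_le_trans (archi_boundP (le_trans ler01 g1)) _.
  by rewrite -natrX ler_nat ltnW// ltn_expl.
have ex : exists n, g < 2 ^+ n by exists n.
case: (ex_minnP ex) => -[|k] gk kmin; first by move: gk; rewrite expr0 ltNge g1.
exists k; rewrite gk andbT leNgt; apply/negP => /kmin; by rewrite ltnn.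
Qed.

Lemma dyadic_ceil (R : realType) (g : R) : 1 < g ->
  exists k, 2 ^+ k < g <= 2 ^+ k.+1.
Proof.
move=> g1; have [k /andP[kg gk]] := dyadic_floor (ltW g1).
move: kg; rewrite le_eqVlt => /predU1P[kg|kg]; last by exists k; rewrite kg ltW.
case: k => [|k] in kg gk *; first by move: g1; rewrite -kg expr0 ltxx.
by exists k; rewrite -kg lexx andbT ltr_eXn2l// ltr1n.
Qed.

Lemma term_le_nneseries (R : realType) (w : nat -> R) k : (forall i, 0 <= w i) ->
  ((w k)%:E <= \sum_(i <oo) (w i)%:E)%E.
Proof.
move=> w0; apply: le_trans (nneseries_lim_ge k.+1 _); last first.
  by move=> i _ _; rewrite lee_fin.
by rewrite big_mkord big_ord_recr/= leeDr// sume_ge0// => i _; rewrite lee_fin.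
Qed.

(** One term is enough: for [2^k < g <= 2^(k+1)] the power [1/(u+eta)] is used, and
    for [2^(-k-1) < g <= 2^(-k)] the power [1/(u-eta)]. *)
Lemma two_power_le_layers (R : realType) (u eta g : R) : 0 < eta < u -> 0 <= g ->
  ((two_power u eta g)%:E <=
   \sum_(k <oo) ((2 `^ (u + eta)^-1) ^+ k.+1 * (2 ^+ k < g)%R%:R)%:E +
   \sum_(k <oo) ((2 `^ (- (u - eta)^-1)) ^+ k * ((2 ^+ k.+1)^-1 < g)%R%:R)%:E)%E.
Proof.
move=> /andP[eta0 etau] g0.
have um : 0 < u - eta by rewrite subr_gt0.
have up : 0 < u + eta by rewrite addr_gt0// (lt_trans eta0).
set F := fun k => (2 `^ (u + eta)^-1) ^+ k.+1 * (2 ^+ k < g)%R%:R.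
set G := fun k => (2 `^ (- (u - eta)^-1)) ^+ k * ((2 ^+ k.+1)^-1 < g)%R%:R.
have F0 k : 0 <= F k by rewrite mulr_ge0// exprn_ge0// powR_ge0.
have G0 k : 0 <= G k by rewrite mulr_ge0// exprn_ge0// powR_ge0.
have SF0 : (0 <= \sum_(k <oo) (F k)%:E)%E by apply: nneseries_ge0 => k _ _; rewrite lee_fin.
have SG0 : (0 <= \sum_(k <oo) (G k)%:E)%E by apply: nneseries_ge0 => k _ _; rewrite lee_fin.
have [g1|g1] := ltP 1 g.
  have [k /andP[kg gk]] := dyadic_ceil g1.
  apply: le_trans (leeDl _ SG0); apply: le_trans (term_le_nneseries k F0).
  rewrite lee_fin /F kg mulr1 /two_power ge_min; apply/orP; right.
  rewrite -powR_mulrn ?powR_ge0// -powRrM mulrC powRrM powR_mulrn//.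
  apply: ge0_ler_powR => //; first by rewrite invr_ge0 ltW.
  by rewrite nnegrE exprn_ge0.
move: g0; rewrite le_eqVlt => /predU1P[g00|g0].
  have -> : two_power u eta g = 0; last exact: adde_ge0.
  rewrite /two_power -g00 (powR0 (x := (u - eta)^-1)) ?invr_eq0 ?(gt_eqF um)//.
  rewrite powR0 ?invr_eq0 ?(gt_eqF up)//.
  exact: minxx.
have : 1 <= g^-1 by rewrite invf_ge1.
move=> /dyadic_floor[k /andP[kg gk]].
apply: le_trans (leeDr _ SF0); apply: le_trans (term_le_nneseries k G0).
rewrite lee_fin /G invf_plt ?posrE ?exprn_gt0// gk mulr1 /two_power ge_min; apply/orP; left.
rewrite -powR_mulrn ?powR_ge0// -powRrM mulNr -mulrN mulrC powRrM.
rewrite powRN powR_mulrn//; apply: ge0_ler_powR.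
- by rewrite invr_ge0 ltW.
- by rewrite nnegrE ltW.
- by rewrite nnegrE invr_ge0 exprn_ge0.
- by rewrite -[leLHS]invrK lef_pV2 ?posrE ?exprn_gt0 ?invr_gt0.
Qed.

(** Integrating the layers leaves two geometric series, the ratios of which are
    less than [1] by the two hypotheses on [a] and [b]. *)
Lemma integral_two_power_le (R : realType) (u eta a b : R) : 0 < eta < u ->
  0 <= a -> 0 <= b ->
  2 `^ (u + eta)^-1 * a < 1 -> 2 `^ (- (u - eta)^-1) * b < 1 ->
  exists2 C : R, 0 <= C &
  forall d (T : measurableType d) (mu : {measure set T -> \bar R})
      (g : T -> R) (D : R),
    measurable_fun setT g -> (forall x, 0 <= g x) -> 0 <= D ->
    (forall k, mu [set x | (2 ^+ k < g x)%R] <= (D * a ^+ k)%:E)%E ->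
    (forall k, mu [set x | ((2 ^+ k.+1)^-1 < g x)%R] <= (D * b ^+ k.+1)%:E)%E ->
    (\int[mu]_x (two_power u eta (g x))%:E <= (C * D)%:E)%E.
Proof.
move=> ueta a0 b0 a1 b1.
set A := 2 `^ (u + eta)^-1 in a1 *; set B := 2 `^ (- (u - eta)^-1) in b1 *.
have A0 : 0 <= A by exact: powR_ge0.
have B0 : 0 <= B by exact: powR_ge0.
have Aa : 0 <= A * a < 1 by rewrite mulr_ge0.
have Bb : 0 <= B * b < 1 by rewrite mulr_ge0.
exists (A / (1 - A * a) + b / (1 - B * b)).
  by apply: addr_ge0; apply: divr_ge0; rewrite // subr_ge0 ltW.
move=> d T mu g D mg g0 D0 muA muB.
have mS (c : R) : measurable [set x | c < g x].
  have := mg measurableT _ (measurable_itv `]c, +oo[).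
  by rewrite setTI preimage_itvoy.
have mI (c : R) : measurable_fun setT (fun x => (c < g x)%R%:R : R).
  rewrite (_ : (fun _ => _) = \1_[set x | c < g x]); first exact: measurable_indic.
  by apply/funext => x; rewrite indicE mem_setE.
have intS (c w : R) (h : R) : 0 <= w -> (mu [set x | (c < g x)%R] <= h%:E)%E ->
    (\int[mu]_x (w * (c < g x)%R%:R)%:E <= (w * h)%:E)%E.
  move=> w0 hh; under eq_integral do rewrite EFinM.
  rewrite ge0_integralZl_EFin//; last by apply/measurable_EFinP; exact: mI.
  rewrite EFinM lee_wpmul2l// ?lee_fin//.
  rewrite (eq_integral (fun x => (\1_[set x | c < g x] x)%:E)); last first.
    by move=> x _; rewrite indicE mem_setE.
  by rewrite integral_indic// setIT.
pose F k x := A ^+ k.+1 * (2 ^+ k < g x)%R%:R.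
pose G k x := B ^+ k * ((2 ^+ k.+1)^-1 < g x)%R%:R.
have F0 k x : (0 <= (F k x)%:E)%E by rewrite lee_fin mulr_ge0// exprn_ge0.
have G0 k x : (0 <= (G k x)%:E)%E by rewrite lee_fin mulr_ge0// exprn_ge0.
have mF k : measurable_fun setT (fun x => (F k x)%:E).
  by apply/measurable_EFinP/measurable_funM => //; exact: mI.
have mG k : measurable_fun setT (fun x => (G k x)%:E).
  by apply/measurable_EFinP/measurable_funM => //; exact: mI.
have mSF : measurable_fun setT (fun x => \sum_(k <oo) (F k x)%:E)%E.
  by apply: (ge0_emeasurable_sum (P := xpredT)) => // k _.
have mSG : measurable_fun setT (fun x => \sum_(k <oo) (G k x)%:E)%E.
  by apply: (ge0_emeasurable_sum (P := xpredT)) => // k _.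
have SF0 x : (0 <= \sum_(k <oo) (F k x)%:E)%E by apply: nneseries_ge0.
have SG0 x : (0 <= \sum_(k <oo) (G k x)%:E)%E by apply: nneseries_ge0.
apply: (@le_trans _ _ (\int[mu]_x
    (\sum_(k <oo) (F k x)%:E + \sum_(k <oo) (G k x)%:E))%E).
  apply: ge0_le_integral => //.
  - by move=> x _; rewrite lee_fin two_power_ge0.
  - apply/measurable_EFinP; apply: measurable_minr.
      exact: (measurableT_comp (measurable_powR _) mg).
    exact: (measurableT_comp (measurable_powR _) mg).
  - exact: emeasurable_funD.
  - by move=> x _; exact: two_power_le_layers.
rewrite ge0_integralD// !integral_nneseries// mulrDl EFinD.
apply: leeD.
- rewrite mulrAC; apply: le_trans (nneseries_geometric_le (mulr_ge0 A0 D0) Aa).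
  apply: lee_nneseries => [k _ _|k _]; first exact: integral_ge0.
  apply: le_trans (intS _ _ _ _ (muA k)) _; first exact: exprn_ge0.
  by rewrite lee_fin (_ : _ * _ = A * D * (A * a) ^+ k)// exprS exprMn; ring.
- rewrite mulrAC; apply: le_trans (nneseries_geometric_le (mulr_ge0 b0 D0) Bb).
  apply: lee_nneseries => [k _ _|k _]; first exact: integral_ge0.
  apply: le_trans (intS _ _ _ _ (muB k)) _; first exact: exprn_ge0.
  by rewrite lee_fin (_ : _ * _ = b * D * (B * b) ^+ k)// exprS exprMn; ring.
Qed.

(** The power [z^(-u)] with both exponents at [0] and at infinity worsened by [e]. *)
Definition decay (R : realType) (u e z : R) : R :=
  z `^ (- u) * Num.max (z `^ e) (z `^ (- e)).

Lemma ltr_powR_gt1 (R : realType) (a x y : R) : 1 < a -> x < y -> a `^ x < a `^ y.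
Proof.
move=> a1 xy; have a0 : 0 < a by exact: lt_trans a1.
by rewrite /powR gt_eqF// ltr_expR ltr_pM2r// ln_gt0.
Qed.

Lemma decayE_small (R : realType) (u e z : R) : 0 <= e -> 0 < z <= 1 ->
  decay u e z = z `^ (- (u + e)).
Proof.
move=> e0 z01; have z0 : 0 < z by case/andP: z01.
rewrite /decay max_r; last by rewrite ger_powR//; lra.
by rewrite opprD powRD// (gt_eqF z0) implybT.
Qed.

Lemma decayE_large (R : realType) (u e z : R) : 0 <= e -> 1 <= z ->
  decay u e z = z `^ (- (u - e)).
Proof.
move=> e0 z1; have z0 : 0 < z by exact: lt_le_trans z1.
rewrite /decay max_l; last by rewrite ler_powR//; lra.
by rewrite opprB addrC powRD// (gt_eqF z0) implybT.
Qed.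

(** A loss of [eta / 2] in the decay of the rearrangement is harmless for the
    function [two_power u eta], which has a margin of [eta].  Since [decay] takes the
    value [2^k] at a power of [2], the layers of [f / S] are measured by evaluating
    the hypothesis at these points. *)
Lemma integral_two_power_of_decay (R : realType) (u eta : R) : 0 < eta < u ->
  exists2 C : R, 0 <= C &
  forall d (T : measurableType d) (mu : {measure set T -> \bar R})
      (f : T -> R[i]) (S D : R), cmeasurable f -> 0 < S -> 0 < D ->
    (forall z, 0 < z ->
      (rearrangement mu f (z * D)%R <= (S / 2 * decay u (eta / 2) z)%:E)%E) ->
    (\int[mu]_x (two_power u eta (cabs (f x) / S))%:E <= (C * D)%:E)%E.
Proof.
move=> ueta; have /andP[eta0 etau] := ueta.
set e := eta / 2; have e0 : 0 < e by rewrite divr_gt0.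
have ee : e < eta by rewrite /e; lra.
(* [decay u e] maps [a ^ k] to [2 ^ k] and [b ^ k] to [2 ^ (- k)] *)
pose a : R := 2 `^ (- (u + e)^-1); pose b : R := 2 `^ ((u - e)^-1).
have a0 : 0 < a by rewrite powR_gt0.
have b0 : 0 < b by rewrite powR_gt0.
have ue : 0 < u + e by lra.
have ue' : 0 < u - e by lra.
have Aa : 2 `^ (u + eta)^-1 * a < 1.
  rewrite -powRD ?pnatr_eq0 ?implybT// -[ltRHS](powRr0 2) ltr_powR_gt1 ?ltr1n//.
  by rewrite subr_lt0 ltf_pV2 ?posrE//; lra.
have Bb : 2 `^ (- (u - eta)^-1) * b < 1.
  rewrite -powRD ?pnatr_eq0 ?implybT// -[ltRHS](powRr0 2) ltr_powR_gt1 ?ltr1n//.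
  by rewrite addrC subr_lt0 ltf_pV2 ?posrE//; lra.
have [C C0 HC] := integral_two_power_le ueta (ltW a0) (ltW b0) Aa Bb.
exists C => // d T mu f S D mf S0 D0 dec.
have a1 : a <= 1.
  by rewrite -[leRHS](powRr0 2) ler_powR ?ler1n// oppr_le0 invr_ge0 ltW.
have b1 : 1 <= b by rewrite -[leLHS](powRr0 2) ler_powR ?ler1n// invr_ge0 ltW.
have key (z w : R) : 0 < z -> decay u e z = w -> 0 < w ->
    (mu [set x | (w < cabs (f x) / S)%R] <= (D * z)%:E)%E.
  move=> z0 zw w0.
  rewrite (_ : [set x | _] = [set x | S * w < cabs (f x)]); last first.
    by apply/seteqP; split=> x /=; rewrite ltr_pdivlMr// mulrC.
  apply: measure_gt_rearrangement => //.
  rewrite mulrC; apply: le_lt_trans (dec _ z0) _.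
  by rewrite zw lte_fin ltr_pM2r// ltr_pdivrMr// ltr_pMr// ltr1n.
apply: HC => //.
- apply: measurable_funM => //; exact: measurable_cabs.
- by move=> x; rewrite divr_ge0 ?cabs_ge0// ltW.
- exact: ltW.
- move=> k; apply: key; rewrite ?exprn_gt0//.
  rewrite decayE_small ?(ltW e0)//; last by rewrite exprn_gt0//= exprn_ile1// ltW.
  have aE : a `^ (- (u + e)) = 2.
    by rewrite -powRrM mulrNN mulVf ?gt_eqF// powRr1.
  by rewrite -powR_mulrn ?(ltW a0)// powRAC aE powR_mulrn.
- move=> k; apply: key; rewrite ?invr_gt0 ?exprn_gt0//.
  rewrite decayE_large ?(ltW e0)//; last by rewrite exprn_ege1.
  have bE : b `^ (- (u - e)) = 2^-1.
    by rewrite -powRrM mulrN mulVf ?gt_eqF// powR_inv1.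
  by rewrite -powR_mulrn ?(ltW b0)// powRAC bE powR_mulrn// exprVn.
Qed.

(** * Profiles of functions in Lorentz spaces *)

Lemma logistic_lower (R : realType) (a b M : R) : 0 < a -> 0 < b -> 0 < M ->
  a <= M * b -> b <= M * a -> (4 * M)^-1 <= logistic a b.
Proof.
move=> a0 b0 M0 ab ba.
rewrite /logistic ler_pdivlMr ?exprn_gt0 ?addr_gt0// mulrC ler_pdivrMr ?mulr_gt0//.
have h1 : a * b <= M * b * b by rewrite ler_pM2r.
have h2 : a * b <= M * a * a by rewrite mulrC ler_pM2r.
have h3 : a * a <= M * b * a by rewrite ler_pM2r.
have h4 : b * b <= M * a * b by rewrite ler_pM2r.
have [le|le] := leP a b.
  have : a * b <= b * b by rewrite ler_pM2r.
  have : a * a <= a * b by rewrite ler_pM2l.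
  rewrite sqrrD; lra.
have : a * b <= a * a by rewrite ler_pM2l// ltW.
have : b * b <= a * b by rewrite ler_pM2r// ltW.
rewrite sqrrD; lra.
Qed.

Lemma poweR_leP (R : realType) (y : \bar R) (c q : R) : 0 < q -> 0 <= c ->
  (0 <= y)%E -> (y `^ q <= c%:E)%E -> (y <= (c `^ q^-1)%:E)%E.
Proof.
move=> q0 c0 y0 yc.
have -> : y = ((y `^ q) `^ q^-1)%E by rewrite -poweRrM mulfV ?gt_eqF// poweRe1.
rewrite -poweR_EFin; apply: gt0_ler_poweR => //.
- by rewrite invr_ge0 ltW.
- by rewrite in_itv/= leey poweR_ge0.
- by rewrite in_itv/= leey lee_fin c0.
Qed.

(** The rearrangement of any function of norm at most [N] is controlled near the
    scale [t ^ m] by one number, [X t], and away from it by a power decay.  The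
    exponent [m] is [1] for a function on the Euclidean space, and the number of
    factors for a kernel, which lives at the scale [t ^ m]. *)
Definition rearrangement_profile (R : realType) (p e : R) (m : nat) (q : \bar R)
    (C : R) : Prop :=
  forall d (T : measurableType d) (mu : {measure set T -> \bar R})
      (f : T -> R[i]) (N : R), 0 < N ->
    (lorentz_norm mu p q f <= N%:E)%E ->
  exists X : measurableTypeR R -> R, [/\ measurable_fun setT X,
    forall t, 0 < t -> 0 < X t,
    (\int[lebesgue_measure]_(t in `]0%R, +oo[) (X t / t)%:E <= C%:E)%E &
    forall t z, 0 < t -> 0 < z ->
      (rearrangement mu f (z * t ^+ m)%R <=
       (C * N * X t `^ fine q^-1 * (t ^+ m) `^ (- p^-1) * decay p^-1 e z)%:E)%E].

(** Here [X t] is the average of [(v^(1/p) f^*(v))^q] against the bump at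
    [v = t ^ m], divided by [N ^ q].  As [f^*] is decreasing, its value at [x] is
    recovered from the part of the average over [v] between [x / 2] and [x]; the
    decay of the bump is the loss [e] in the exponents.  The summand [logistic (t ^ l) 1] only makes [X]
    positive, for functions that vanish almost everywhere. *)
Lemma lorentz_profile_fin (R : realType) (p e : R) (m : nat) (q : R) :
  0 < p -> 0 < e -> (0 < m)%N -> 0 < q ->
  exists2 C : R, 0 < C & rearrangement_profile p e m q%:E C.
Proof.
move=> p0 e0 m0 q0.
set u := p^-1; have u0 : 0 < u by rewrite invr_gt0.
pose k := e * q; have k0 : 0 < k by rewrite mulr_gt0.
pose l := m%:R * k; have l0 : 0 < l by rewrite mulr_gt0// ltr0n.
pose C0 : R := 8 `^ q^-1 * 2 `^ e * 2 `^ u.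
have C00 : 0 < C0 by rewrite !mulr_gt0// powR_gt0.
(* [C0] comes from the decay and [2 / l] from the integral of [X] *)
exists (C0 + 2 / l); first by rewrite addr_gt0// divr_gt0.
rewrite /rearrangement_profile inver (gt_eqF q0)/=.
move=> d T mu f N N0; rewrite /lorentz_norm integral_itv0y.
set fs := rearrangement mu f.
pose H (v : measurableTypeR R) :=
  (((v `^ u)%:E * fs v) `^ q * ((Num.max v 0)^-1)%:E)%E.
rewrite -[X in (X `^ _)%E]/(\int[lebesgue_measure]_v H v)%E => IN.
have H0 v : (0 <= H v)%E by rewrite mule_ge0 ?poweR_ge0// lee_fin invmax0_ge0.
have mH : measurable_fun setT H.
  apply: emeasurable_funM.
    apply: (measurableT_comp (measurable_poweR q)).
    apply: emeasurable_funM; last exact: measurable_rearrangement.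
    by apply/measurable_EFinP; exact: measurable_powR.
  by apply/measurable_EFinP; exact: measurable_invmax0.
have Hneg v : v <= 0 -> H v = 0%E.
  by move=> v0; rewrite /H max_r// invr0 mule0.
have I0 : (0 <= \int[lebesgue_measure]_v H v)%E by exact: integral_ge0.
have {}IN : (\int[lebesgue_measure]_v H v <= (N `^ q)%:E)%E.
  have := @poweR_leP _ _ N q^-1 _ (ltW N0) I0 IN.
  by rewrite invrK; apply; rewrite invr_gt0.
have [] := integral_logistic_average k0 l0 mH H0 Hneg.
set X0 := fun t : measurableTypeR R => _.
move=> mX0 IX0.
have X00 t : (0 <= X0 t)%E.
  by apply: integral_ge0 => v _; rewrite mule_ge0// lee_fin logistic_ge0// powR_ge0.
have mK t : measurable_fun setT (fun v : measurableTypeR R =>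
    (H v * (logistic (t `^ l) (v `^ k))%:E)%E).
  apply: emeasurable_funM => //; apply/measurable_EFinP/measurable_logistic => //.
  by move=> v _; rewrite addr_ge0 ?powR_ge0.
have X0N t : (X0 t <= (N `^ q)%:E)%E.
  apply: le_trans IN; apply: ge0_le_integral => //.
  - by move=> v _; rewrite mule_ge0// lee_fin logistic_ge0// powR_ge0.
  - move=> v _; rewrite -[leRHS]mule1 lee_wpmul2l// lee_fin.
    by rewrite logistic_le1 ?powR_ge0.
have X0f t : X0 t \is a fin_num.
  by rewrite ge0_fin_numE//; apply: le_lt_trans (X0N t) (ltry _).
have Nq0 : 0 < N `^ q by exact: powR_gt0.
pose X (t : measurableTypeR R) := fine (X0 t) / N `^ q + logistic (t `^ l) 1.
have mk1 : measurable_fun setT (fun t : measurableTypeR R => logistic (t `^ l) 1).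
  apply: measurable_logistic => //.
  by move=> t _; rewrite addr_ge0 ?powR_ge0.
have mX : measurable_fun setT X.
  apply: measurable_funD => //; apply: measurable_funM => //.
  apply: (measurableT_comp _ mX0).
  exact: fine_measurable.
have Xge t : fine (X0 t) <= N `^ q * X t.
  rewrite mulrDr mulrC divfK ?gt_eqF// lerDl mulr_ge0 ?(ltW Nq0)//.
  by rewrite logistic_ge0 ?powR_ge0.
have Xpos t : 0 < t -> 0 < X t.
  move=> t0; rewrite ltr_wpDl//.
    by rewrite divr_ge0 ?fine_ge0 ?(ltW Nq0).
  by rewrite /logistic divr_gt0 ?mulr_gt0 ?exprn_gt0 ?ltr_pwDr ?powR_gt0 ?powR_ge0.
exists X; split => //.
- rewrite (@le_trans _ _ (2 / l)%:E)//; last by rewrite lee_fin lerDr ltW.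
  pose G1 (t : measurableTypeR R) := (((N `^ q)^-1)%:E * (X0 t * (t^-1)%:E))%E.
  pose G2 (t : measurableTypeR R) := (logistic (t `^ l) 1 / t)%:E.
  rewrite (eq_integral (fun t => (G1 t + G2 t)%E)); last first.
    move=> t _; rewrite /G1 /G2 -[X0 t]fineK// -!EFinM -EFinD mulrDl.
    by congr (_ + _)%:E; rewrite mulrCA mulrA.
  have pos (t : R) : `]0%R, +oo[%classic t -> 0 <= t^-1.
    by move=> /itv0y_gt0 t0; rewrite invr_ge0 ltW.
  have mV := @measurable_inv_itv0y R.
  have mV' : measurable_fun (`]0%R, +oo[%classic : set (measurableTypeR R))
      (fun t : measurableTypeR R => (X0 t * (t^-1)%:E)%E).
    apply: emeasurable_funM; first exact: measurable_funTS.
    exact/measurable_EFinP.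
  have VX0 (t : R) : `]0%R, +oo[%classic t -> (0 <= X0 t * (t^-1)%:E)%E.
    by move=> t0; rewrite mule_ge0// lee_fin pos.
  rewrite ge0_integralD//.
  + rewrite (_ : 2 / l = l^-1 + l^-1); last by rewrite mulr2n mulrDl mul1r.
    rewrite EFinD; apply: leeD.
      rewrite ge0_integralZl_EFin//; last by rewrite invr_ge0 ltW.
      have -> : l^-1%:E = ((N `^ q)^-1%:E * (l^-1%:E * (N `^ q)%:E))%E :> \bar R.
        by rewrite -!EFinM mulrCA mulVf ?gt_eqF// mulr1.
      rewrite lee_wpmul2l// ?lee_fin ?invr_ge0 ?(ltW Nq0)//.
      apply: le_trans IX0 _; rewrite lee_wpmul2l// lee_fin invr_ge0 ltW//.
    exact: integral_logistic.
  + by move=> t t0; rewrite /G1 mule_ge0 ?VX0// lee_fin invr_ge0 ltW.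
  + exact: measurable_funeM.
  + by move=> t t0; rewrite lee_fin mulr_ge0 ?pos// logistic_ge0 ?powR_ge0.
  + by apply/measurable_EFinP/measurable_funM => //; exact: measurable_funTS.
- move=> t z t0 z0.
  set T0 := t ^+ m; have T00 : 0 < T0 by rewrite exprn_gt0.
  set x := z * T0; have x0 : 0 < x by rewrite mulr_gt0.
  set W := Num.max (z `^ e) (z `^ (- e)).
  have W0 : 0 < W by rewrite lt_max powR_gt0.
  pose M := 2 `^ k * W `^ q; have M0 : 0 < M by rewrite mulr_gt0// powR_gt0.
  have tl : t `^ l = T0 `^ k.
    by rewrite /l powRrM powR_mulrn// ltW.
  have zk : z `^ k <= W `^ q.
    rewrite /k powRrM; apply: ge0_ler_powR; rewrite ?nnegrE ?powR_ge0 ?(ltW q0) ?(ltW W0)//.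
    by rewrite le_max lexx.
  have zNk : z `^ (- k) <= W `^ q.
    rewrite /k -mulNr powRrM; apply: ge0_ler_powR;
      rewrite ?nnegrE ?powR_ge0 ?(ltW q0) ?(ltW W0)//.
    by rewrite le_max lexx orbT.
  have kl v : x / 2 <= v <= x -> (4 * M)^-1 <= logistic (t `^ l) (v `^ k).
    move=> /andP[xv vx]; have v0 : 0 < v by apply: lt_le_trans xv; rewrite divr_gt0.
    rewrite tl; apply: logistic_lower; rewrite ?powR_gt0//.
      apply: (@le_trans _ _ ((2 * v * z^-1) `^ k)).
        apply: ge0_ler_powR; rewrite ?nnegrE ?(ltW k0) ?(ltW T00)
          ?mulr_ge0 ?invr_ge0 ?(ltW v0) ?(ltW z0)//.
        by rewrite ler_pdivlMr// mulrC -/x -ler_pdivrMl// mulrC.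
      rewrite !powRM ?mulr_ge0 ?invr_ge0 ?(ltW v0) ?(ltW z0)// /M mulrAC.
      rewrite ler_wpM2r ?powR_ge0// ler_wpM2l ?powR_ge0//.
      by rewrite -powR_inv1 ?(ltW z0)// -powRrM mulN1r.
    apply: (@le_trans _ _ ((z * T0) `^ k)).
      by apply: ge0_ler_powR; rewrite ?nnegrE ?(ltW k0) ?(ltW v0) ?(ltW x0).
    rewrite powRM ?(ltW z0) ?(ltW T00)// ler_wpM2r ?powR_ge0//.
    rewrite (le_trans zk)// /M ler_peMl ?powR_ge0//.
    by rewrite -[leLHS](powRr0 2) ler_powR ?ler1n// ltW.
  have fs0 v : (0 <= fs v)%E by exact: rearrangement_ge0.
  pose Y := (((x / 2) `^ u)%:E * fs x)%E.
  have Y0 : (0 <= Y)%E by rewrite mule_ge0// lee_fin powR_ge0.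
  (* the interval from [x / 2] to [x] has length [x / 2], and [1 / v >= 1 / x] on it *)
  have YX0 : (Y `^ q * ((8 * M)^-1)%:E <= X0 t)%E.
    pose J : set (measurableTypeR R) := `[x / 2, x]%classic.
    have mJ : measurable J by exact: measurable_itv.
    apply: (@le_trans _ _ (\int[lebesgue_measure]_(v in J)
        (cst (Y `^ q * (x^-1 * (4 * M)^-1)%:E)%E v))%E).
      have JE : lebesgue_measure J = (x / 2)%:E.
        rewrite /J lebesgue_measure_itv/= lte_fin ltr_pdivrMr// ltr_pMr// ltr1n.
        by rewrite -EFinB; congr _%:E; lra.
      rewrite integral_cst// [X in (_ <= _ * X)%E]JE -muleA -EFinM.
      apply: lee_wpmul2l; first exact: poweR_ge0.
      by rewrite lee_fin le_eqVlt; apply/orP; left; apply/eqP; field; rewrite !gt_eqF.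
    apply: (@le_trans _ _ (\int[lebesgue_measure]_(v in J)
        (H v * (logistic (t `^ l) (v `^ k))%:E))%E); last first.
      apply: ge0_subset_integral => // v _.
      by rewrite mule_ge0// lee_fin logistic_ge0// powR_ge0.
    apply: ge0_le_integral => //.
    - move=> v _ /=; rewrite mule_ge0 ?poweR_ge0// lee_fin.
      by rewrite divr_ge0 ?invr_ge0 ?(ltW x0)// mulr_ge0// ltW.
    - by apply: measurable_funTS.
    move=> v; rewrite /J/= in_itv/= => /[dup] vJ /andP[xv vx].
    have v0 : 0 < v by apply: lt_le_trans xv; rewrite divr_gt0.
    rewrite EFinM muleA; apply: lee_pmul.
    - by rewrite mule_ge0 ?poweR_ge0// lee_fin invr_ge0 ltW.
    - by rewrite lee_fin invr_ge0 mulr_ge0// ltW.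
    - rewrite /H max_l ?(ltW v0)//; apply: lee_pmul.
      + exact: poweR_ge0.
      + by rewrite lee_fin invr_ge0 ltW.
      + apply: gt0_ler_poweR; rewrite ?(ltW q0)// ?in_itv/= ?leey ?andbT//.
          by rewrite mule_ge0// lee_fin powR_ge0.
        apply: lee_pmul => //; first by rewrite lee_fin powR_ge0.
          rewrite lee_fin; apply: ge0_ler_powR; rewrite ?nnegrE ?(ltW u0) ?(ltW v0)//.
          by rewrite divr_ge0// ltW.
        exact: rearrangement_anti.
      + by rewrite lee_fin lef_pV2.
    - by rewrite lee_fin kl.
  have Yle : (Y `^ q <= (8 * M * (N `^ q * X t))%:E)%E.
    have h : (Y `^ q * ((8 * M)^-1)%:E <= (N `^ q * X t)%:E)%E.
      by apply: le_trans YX0 _; rewrite -[X0 t]fineK// lee_fin.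
    have M80 : 0 < 8 * M by rewrite mulr_gt0.
    rewrite EFinM muleC -lee_pdivrMr//.
  have Xt0 := Xpos _ t0.
  have {}Yle : (Y <= (8 `^ q^-1 * 2 `^ e * W * (N * X t `^ q^-1))%:E)%E.
    apply: le_trans (poweR_leP q0 _ Y0 Yle) _.
      by rewrite !mulr_ge0 ?powR_ge0// ?ltW.
    rewrite lee_fin !powRM ?mulr_ge0 ?powR_ge0 ?(ltW Xt0) ?(ltW Nq0) ?(ltW M0)//.
    rewrite -!powRrM /k mulfK ?gt_eqF// mulfV ?gt_eqF//.
    by rewrite !powRr1 ?(ltW W0) ?(ltW N0)// !mulrA.
  have x20 : 0 < x / 2 by rewrite divr_gt0.
  have fsY : fs x = (((x / 2) `^ (- u))%:E * Y)%E.
    rewrite /Y muleA -EFinM -powRD; last by rewrite (gt_eqF x20) implybT.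
    by rewrite addNr powRr0 mul1e.
  rewrite fsY; apply: (@le_trans _ _
      (((x / 2) `^ (- u))%:E * (8 `^ q^-1 * 2 `^ e * W * (N * X t `^ q^-1))%:E)%E).
    by rewrite lee_wpmul2l// lee_fin powR_ge0.
  rewrite -EFinM lee_fin.
  apply: (@le_trans _ _ (C0 * N * X t `^ q^-1 * T0 `^ (- u) * decay u e z)).
    rewrite /decay -/W /x /C0 !powRM ?invr_ge0 ?(ltW z0) ?(ltW T00)//.
      rewrite -(powR_inv1 (a := 2))// -powRrM mulrNN mul1r le_eqVlt.
      by apply/orP; left; apply/eqP; ring.
    by rewrite mulr_ge0// ltW.
  rewrite ler_wpM2r ?mulr_ge0 ?powR_ge0 ?(ltW W0)//.
  rewrite ler_wpM2r ?powR_ge0// ler_wpM2r ?powR_ge0// ler_wpM2r ?(ltW N0)//.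
  by rewrite lerDl divr_ge0 ?(ltW l0).
Qed.

(** For [q = +oo] the power decay is the definition of the norm, and [X] occurs with
    the exponent [0]: any positive integrable function will do. *)
Lemma lorentz_profile_inf (R : realType) (p e : R) (m : nat) :
  0 < p -> 0 < e -> exists2 C : R, 0 < C & rearrangement_profile p e m +oo%E C.
Proof.
move=> p0 e0; exists 1 => //; rewrite /rearrangement_profile invey/=.
move=> d T mu f N N0 fN.
exists (fun t : measurableTypeR R => logistic (t `^ 1) 1); split.
- apply: measurable_logistic => //.
  by move=> t _; rewrite addr_ge0 ?powR_ge0.
- by move=> t t0; rewrite /logistic divr_gt0 ?mulr_gt0 ?exprn_gt0 ?addr_gt0 ?powR_gt0.
- by have := @integral_logistic R 1 1 ltr01 ltr01; rewrite invr1.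
move=> t z t0 z0; rewrite powRr0 mul1r mulr1.
have T0 : 0 < t ^+ m by rewrite exprn_gt0.
set x := z * t ^+ m; have x0 : 0 < x by rewrite mulr_gt0.
have h : ((x `^ p^-1)%:E * rearrangement mu f x <= N%:E)%E.
  by apply: le_trans fN; apply: ereal_sup_ubound; exists x.
have -> : rearrangement mu f x =
    ((x `^ (- p^-1))%:E * ((x `^ p^-1)%:E * rearrangement mu f x))%E.
  rewrite muleA -EFinM -powRD ?(gt_eqF x0) ?implybT//.
  by rewrite addNr powRr0 mul1e.
apply: (@le_trans _ _ ((x `^ (- p^-1))%:E * N%:E)%E).
  by rewrite lee_wpmul2l// lee_fin powR_ge0.
rewrite -EFinM lee_fin /x powRM ?(ltW z0) ?(ltW T0)// /decay.
rewrite [leRHS](_ : _ = z `^ (- p^-1) * (t ^+ m) `^ (- p^-1) * N *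
  Num.max (z `^ e) (z `^ (- e))); last by ring.
rewrite ler_peMr ?mulr_ge0 ?powR_ge0 ?(ltW N0)// le_max.
have [z1|z1] := leP 1 z; apply/orP; [left|right].
  by rewrite -[leLHS](powRr0 z) ler_powR// ltW.
by rewrite -[leLHS](powRr0 z) ger_powR ?z0 ?(ltW z1)// oppr_le0 ltW.
Qed.

(** The form in which membership in a Lorentz space is used: at each scale [t] the
    function, divided by an explicit constant, has a two-power integral at most
    [C * t ^ m], and the [X t] in this constant is integrable for [dt/t]. *)
Lemma lorentz_profile (R : realType) (p eta : R) (m : nat) (q : \bar R) :
  0 < p -> 0 < eta < p^-1 -> (0 < m)%N -> (0 < q)%E ->
  exists2 C : R, 0 < C &
  forall d (T : measurableType d) (mu : {measure set T -> \bar R})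
      (f : T -> R[i]) (N : R), cmeasurable f -> 0 < N ->
    (lorentz_norm mu p q f <= N%:E)%E ->
  exists X : measurableTypeR R -> R, [/\ measurable_fun setT X,
    forall t, 0 < t -> 0 < X t,
    (\int[lebesgue_measure]_(t in `]0%R, +oo[) (X t / t)%:E <= C%:E)%E &
    forall t, 0 < t ->
      (\int[mu]_x (two_power p^-1 eta (cabs (f x) /
         (C * N * X t `^ (fine q^-1) * (t ^+ m) `^ (- p^-1))))%:E <=
       (C * t ^+ m)%:E)%E].
Proof.
move=> p0 etap m0 q0; have /andP[eta0 etau] := etap.
have e0 : 0 < eta / 2 by rewrite divr_gt0.
have [C2 C20 hC2] := integral_two_power_of_decay etap.
suff [C1 C10 hC1] : exists2 C : R, 0 < C & rearrangement_profile p (eta / 2) m q C.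
  have C0 : 0 < 2 * C1 + C2 by rewrite ltr_pwDl// mulr_gt0.
  exists (2 * C1 + C2) => // d T mu f N mf N0 fN.
  have [X [mX X0 IX dX]] := hC1 d T mu f N N0 fN.
  exists X; split => //.
    by apply: le_trans IX _; rewrite lee_fin; lra.
  move=> t t0; have T0 : 0 < t ^+ m by rewrite exprn_gt0.
  apply: (@le_trans _ _ (C2 * t ^+ m)%:E); last first.
    by rewrite lee_fin ler_wpM2r ?(ltW T0)//; lra.
  apply: hC2 => //.
    by rewrite !mulr_gt0// powR_gt0// X0.
  move=> z z0; apply: le_trans (dX _ _ t0 z0) _; rewrite lee_fin.
  set Q := X t `^ _; set D := decay _ _ _; set V := _ `^ (- p^-1).
  have P0 : 0 <= N * Q * V * D.
    by rewrite !mulr_ge0 ?powR_ge0 ?(ltW N0)// le_max powR_ge0.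
  rewrite [leLHS](_ : _ = C1 * (N * Q * V * D)); last by ring.
  rewrite [leRHS](_ : _ = (C1 + C2 / 2) * (N * Q * V * D)); last by field.
  by rewrite ler_wpM2r//; lra.
case: q q0 => [q|_|//]; last exact: lorentz_profile_inf.
by rewrite lte_fin => q0; exact: lorentz_profile_fin.
Qed.

(** * Integration over powers of a measure *)

Section tuple_integral.
Context d (T : measurableType d) (R : realType).
Variable mu : {sigma_finite_measure set T -> \bar R}.
Local Open Scope ereal_scope.

Lemma measurable_cons_pair n :
  measurable_fun setT (fun xt : T * n.-tuple T => [tuple of xt.1 :: xt.2]).
Proof. exact: measurable_cons. Qed.

Lemma ge0_integral_tuple0 (h : 0.-tuple T -> \bar R) : measurable_fun setT h ->
  (forall t, 0 <= h t) -> \int[tuple_measure mu 0]_t h t = h [tuple].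
Proof. by move=> mh h0; rewrite integral_dirac// diracT mul1e. Qed.

Lemma ge0_integral_tupleS n (h : n.+1.-tuple T -> \bar R) :
  measurable_fun setT h -> (forall t, 0 <= h t) ->
  \int[tuple_measure mu n.+1]_t h t =
  \int[mu]_x \int[tuple_measure mu n]_t h [tuple of x :: t].
Proof.
move=> mh h0.
transitivity (\int[pushforward (mu \x tuple_measure mu n)
    (fun xt : T * n.-tuple T => [tuple of xt.1 :: xt.2])]_t h t).
  by apply: eq_measure_integral; first exact: measurable_cons_pair.
rewrite (ge0_integral_pushforward (@measurable_cons_pair n))//.
rewrite preimage_setT fubini_tonelli1//.
  by apply: measurableT_comp => //; exact: measurable_cons_pair.
by move=> xt; exact: h0.
Qed.

Lemma measurable_cons_left n (x : T) :
  measurable_fun setT (fun t : n.-tuple T => [tuple of x :: t]).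
Proof. by apply: measurable_cons. Qed.

Lemma measurable_prod_tnth n (g : 'I_n -> T -> R) :
  (forall i, measurable_fun setT (g i)) ->
  measurable_fun setT (fun t : n.-tuple T => \prod_(i < n) g i (tnth t i))%R.
Proof.
move=> mg; apply: measurable_prod => i _.
by apply: measurableT_comp => //; exact: measurable_tnth.
Qed.

Lemma integral_tuple_prod n (g : 'I_n -> T -> R) :
  (forall i, measurable_fun setT (g i)) -> (forall i x, (0 <= g i x)%R) ->
  \int[tuple_measure mu n]_t (\prod_(i < n) g i (tnth t i))%:E =
  \prod_(i < n) \int[mu]_x (g i x)%:E.
Proof.
elim: n g => [g mg g0|n IH g mg g0].
  rewrite ge0_integral_tuple0 ?big_ord0//.
  - by apply/measurable_EFinP; exact: measurable_prod_tnth.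
  - by move=> t; rewrite lee_fin prodr_ge0.
rewrite ge0_integral_tupleS; last 2 first.
- by apply/measurable_EFinP; exact: measurable_prod_tnth.
- by move=> t; rewrite lee_fin prodr_ge0.
rewrite big_ord_recl -IH//.
rewrite -ge0_integralZr//; last 3 first.
- exact/measurable_EFinP.
- by move=> x _; rewrite lee_fin.
- by apply: integral_ge0 => t _; rewrite lee_fin prodr_ge0.
apply: eq_integral => x _.
rewrite -ge0_integralZl_EFin//; last 2 first.
- by move=> t _; rewrite lee_fin prodr_ge0.
- apply/measurable_EFinP; exact: (@measurable_prod_tnth n (fun i => g (lift ord0 i))).
apply: eq_integral => t _; rewrite -EFinM big_ord_recl tnth0; congr (_ * _)%:E.
by apply: eq_bigr => i _; rewrite tnthS.
Qed.

(** Maps acting on each coordinate by a measure-preserving map preserve the power of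
    the measure. *)
Lemma ge0_integral_tuple_map n (tau : 'I_n -> T -> T) (h : n.-tuple T -> \bar R) :
  (forall i, measurable_fun setT (tau i)) ->
  (forall i (k : T -> \bar R), measurable_fun setT k -> (forall x, 0 <= k x) ->
    \int[mu]_x k (tau i x) = \int[mu]_x k x) ->
  measurable_fun setT h -> (forall t, 0 <= h t) ->
  \int[tuple_measure mu n]_t h [tuple tau i (tnth t i) | i < n] =
  \int[tuple_measure mu n]_t h t.
Proof.
move=> mtau inv mh h0.
have mmap k (s : 'I_k -> T -> T) : (forall i, measurable_fun setT (s i)) ->
    measurable_fun setT (fun t : k.-tuple T => [tuple s i (tnth t i) | i < k]).
  move=> ms; apply/measurable_fun_tnthP => i.
  rewrite (_ : _ \o _ = fun t => s i (tnth t i)); last first.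
    by apply/funext => t /=; rewrite tnth_mktuple.
  by apply: measurableT_comp => //; exact: measurable_tnth.
elim: n tau h mtau inv mh h0 => [tau h mtau inv mh h0|n IH tau h mtau inv mh h0].
  by apply: eq_integral => t _; rewrite [t]tuple0 [X in h X = _]tuple0.
rewrite !ge0_integral_tupleS//; last exact: measurableT_comp (mmap _ _ mtau).
have mhc x : measurable_fun setT (fun t : n.-tuple T => h [tuple of x :: t]).
  exact: (measurableT_comp mh (measurable_cons_left x)).
pose k x := \int[tuple_measure mu n]_t h [tuple of x :: t].
have mk : measurable_fun setT k.
  apply: (measurable_fun_fubini_tonelli_F (m2 := tuple_measure mu n)
    (fun xt : T * n.-tuple T => h [tuple of xt.1 :: xt.2])) => //.
  by apply: measurableT_comp => //; exact: measurable_cons_pair.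
rewrite -[RHS](inv ord0 k)//; last by move=> x; exact: integral_ge0.
apply: eq_integral => x _; rewrite /k.
rewrite -(IH (fun i => tau (lift ord0 i)) (fun t => h [tuple of tau ord0 x :: t])
  (fun i => mtau _) (fun i => inv _) (mhc _) (fun t => h0 _)).
apply: eq_integral => t _; congr h; apply: eq_from_tnth => i.
rewrite tnth_mktuple; case: (unliftP ord0 i) => [j|] ->.
  by rewrite !tnthS tnth_mktuple.
by rewrite !tnth0.
Qed.

End tuple_integral.

(** * Translations and reflections of Euclidean space *)

Lemma ge0_integral_lebesgue_pushforward (R : realType)
    (s : measurableTypeR R -> measurableTypeR R) (k : R -> \bar R) :
  measurable_fun setT s ->
  (forall a b, lebesgue_measure (s @^-1` `]a, b]%classic) =
    lebesgue_measure (`]a, b]%classic : set (measurableTypeR R))) ->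
  measurable_fun setT (k : measurableTypeR R -> _) -> (forall x, 0 <= k x)%E ->
  (\int[lebesgue_measure]_x k (s x) = \int[lebesgue_measure]_x k x)%E.
Proof.
move=> ms inv mk k0.
rewrite -[LHS](ge0_integral_pushforward ms lebesgue_measure
  (D := setT) measurableT mk); last first.
  by move=> x _; exact: k0.
apply: eq_measure_integral => // A mA _.
apply/esym/lebesgue_measure_unique => // _ [[a b]] _ <-.
by apply/esym; exact: inv.
Qed.

Lemma ge0_integral_reflect (R : realType) (a : R) (k : R -> \bar R) :
  measurable_fun setT (k : measurableTypeR R -> _) -> (forall x, 0 <= k x)%E ->
  (\int[lebesgue_measure]_x k (a - x)%R = \int[lebesgue_measure]_x k x)%E.
Proof.
apply: (ge0_integral_lebesgue_pushforward (s := fun x => a - x)).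
  exact: measurable_funB.
move=> b c; rewrite (_ : _ @^-1` _ = `[a - c, a - b[%classic); last first.
  apply/seteqP; split=> x /=; rewrite !in_itv/=; lra.
rewrite !lebesgue_measure_itv/= !lte_fin ltrD2l ltrN2.
by case: ifP => // _; rewrite -!EFinB; congr _%:E; ring.
Qed.

Lemma ge0_integral_translate (R : realType) (a : R) (k : R -> \bar R) :
  measurable_fun setT (k : measurableTypeR R -> _) -> (forall x, 0 <= k x)%E ->
  (\int[lebesgue_measure]_x k (x - a)%R = \int[lebesgue_measure]_x k x)%E.
Proof.
apply: (ge0_integral_lebesgue_pushforward (s := fun x => x - a)).
  exact: measurable_funB.
move=> b c; rewrite (_ : _ @^-1` _ = `]b + a, c + a]%classic); last first.
  apply/seteqP; split=> x /=; rewrite !in_itv/=; lra.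
rewrite !lebesgue_measure_itv/= !lte_fin ltrD2r.
by case: ifP => // _; rewrite -!EFinB; congr _%:E; ring.
Qed.

Definition subtup (R : realType) n (x y : n.-tuple (measurableTypeR R)) :
    n.-tuple (measurableTypeR R) :=
  [tuple (tnth x j : R) - tnth y j | j < n].

Section euclidean.
Context (R : realType) (n : nat).
Let E := n.-tuple (measurableTypeR R).
Local Notation mu := (borel_leb R n).

Lemma measurable_subtup d (T : measurableType d) (f g : T -> E) :
  measurable_fun setT f -> measurable_fun setT g ->
  measurable_fun setT (fun t => subtup (f t) (g t)).
Proof.
move=> mf mg; apply/measurable_fun_tnthP => i.
rewrite (_ : _ \o _ = fun t => (tnth (f t) i : R) - tnth (g t) i); last first.
  by apply/funext => t /=; rewrite tnth_mktuple.
apply: measurable_funB.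
- exact: measurableT_comp (measurable_tnth i) mf.
- exact: measurableT_comp (measurable_tnth i) mg.
Qed.

Lemma ge0_integral_subtupr (x : E) (h : E -> \bar R) :
  measurable_fun setT h -> (forall t, 0 <= h t)%E ->
  (\int[mu]_y h (subtup x y) = \int[mu]_y h y)%E.
Proof.
move=> mh h0.
apply: (@ge0_integral_tuple_map _ (measurableTypeR R) R (@lebesgue_measure R) n
  (fun i b => (tnth x i : R) - b) h _ _ mh h0).
- by move=> i; exact: measurable_funB.
- by move=> i k mk k0; exact: ge0_integral_reflect.
Qed.

Lemma ge0_integral_subtupl (y : E) (h : E -> \bar R) :
  measurable_fun setT h -> (forall t, 0 <= h t)%E ->
  (\int[mu]_x h (subtup x y) = \int[mu]_x h x)%E.
Proof.
move=> mh h0.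
apply: (@ge0_integral_tuple_map _ (measurableTypeR R) R (@lebesgue_measure R) n
  (fun i b => (b : R) - tnth y i) h _ _ mh h0).
- by move=> i; exact: measurable_funB.
- by move=> i k mk k0; exact: ge0_integral_translate.
Qed.

End euclidean.

(** * The weak estimate at one scale *)

Lemma measurable_two_power (R : realType) d (T : measurableType d) (u eta : R)
    (g : T -> R) : measurable_fun setT g ->
  measurable_fun setT (fun x => two_power u eta (g x)).
Proof.
move=> mg; apply: measurable_minr.
  exact: (measurableT_comp (measurable_powR _) mg).
exact: (measurableT_comp (measurable_powR _) mg).
Qed.

Section nonnegative_convolution.
Context (R : realType) (n m : nat).
Let E := n.-tuple (measurableTypeR R).
Local Notation mu := (borel_leb R n).
Local Notation nu := (borel_leb_pow R n m).

Lemma measurable_convolved (g : 'I_m -> E -> R) :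
  (forall i, measurable_fun setT (g i)) -> forall i,
  measurable_fun setT (fun xy : E * m.-tuple E => g i (subtup xy.1 (tnth xy.2 i))).
Proof.
move=> mg i; apply: (measurableT_comp (mg i)).
apply: measurable_subtup; first exact: measurable_fst.
by apply: (measurableT_comp (measurable_tnth i)); exact: measurable_snd.
Qed.

(** The endpoint with a bounded kernel. *)
Lemma integral_prod_convolved (g : 'I_m -> E -> R) (x : E) :
  (forall i, measurable_fun setT (g i)) -> (forall i y, 0 <= g i y) ->
  (\int[nu]_y (\prod_(i < m) g i (subtup x (tnth y i)))%:E =
   \prod_(i < m) \int[mu]_y (g i y)%:E)%E.
Proof.
move=> mg g0.
have mgx i : measurable_fun setT (fun y : E => g i (subtup x y)).
  by apply: (measurableT_comp (mg i)); exact: measurable_subtup.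
rewrite (@integral_tuple_prod _ E R mu m (fun i y => g i (subtup x y)))//.
apply: eq_bigr => i _.
apply: (@ge0_integral_subtupr R n x (fun y => (g i y)%:E)).
  exact/measurable_EFinP.
by move=> t; rewrite lee_fin.
Qed.

(** The endpoint where one function and the kernel are integrable: for a fixed [y]
    the integral over [x] is invariant under the translation by [y_i]. *)
Lemma integral_convolved_mul (g : E -> R) (k : m.-tuple E -> R) (i : 'I_m) :
  measurable_fun setT g -> (forall y, 0 <= g y) ->
  measurable_fun setT k -> (forall y, 0 <= k y) ->
  (\int[mu]_x \int[nu]_y (g (subtup x (tnth y i)) * k y)%:E =
   \int[mu]_y (g y)%:E * \int[nu]_y (k y)%:E)%E.
Proof.
move=> mg g0 mk k0.
have mgi := measurable_convolved (fun=> mg) i.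
rewrite (fubini_tonelli (m1 := mu) (m2 := nu)
  (fun xy => (g (subtup xy.1 (tnth xy.2 i)) * k xy.2)%:E)); last 2 first.
- apply/measurable_EFinP/measurable_funM => //.
  by apply: (measurableT_comp mk); exact: measurable_snd.
- by move=> xy; rewrite lee_fin mulr_ge0.
rewrite -ge0_integralZl//; last 3 first.
- exact/measurable_EFinP.
- by move=> y _; rewrite lee_fin.
- by apply: integral_ge0 => y _; rewrite lee_fin.
apply: eq_integral => y _ /=.
under eq_integral do rewrite mulrC EFinM.
rewrite ge0_integralZl_EFin//; last 2 first.
- by move=> x _; rewrite lee_fin.
- apply/measurable_EFinP/(measurableT_comp mg).
  exact: measurable_subtup.
rewrite muleC; congr (_ * _)%E.
apply: (@ge0_integral_subtupl R n (tnth y i) (fun x => (g x)%:E)).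
  exact/measurable_EFinP.
by move=> t; rewrite lee_fin.
Qed.

Definition nnconv (g : 'I_m -> E -> R) (k : m.-tuple E -> R) (x : E) : \bar R :=
  (\int[nu]_y ((\prod_(i < m) g i (subtup x (tnth y i))) * k y)%:E)%E.

Lemma measurable_nnconv (g : 'I_m -> E -> R) (k : m.-tuple E -> R) :
  (forall i, measurable_fun setT (g i)) -> (forall i y, 0 <= g i y) ->
  measurable_fun setT k -> (forall y, 0 <= k y) ->
  measurable_fun setT (nnconv g k).
Proof.
move=> mg g0 mk k0.
apply: (measurable_fun_fubini_tonelli_F (m2 := nu) (fun xy : E * m.-tuple E =>
  ((\prod_(i < m) g i (subtup xy.1 (tnth xy.2 i))) * k xy.2)%:E)).
  apply/measurable_EFinP/measurable_funM.
    by apply: measurable_prod => i _; exact: measurable_convolved.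
  by apply: (measurableT_comp mk); exact: measurable_snd.
by move=> xy; rewrite lee_fin mulr_ge0// prodr_ge0.
Qed.

(** In the bound given by [two_power_mixing] for the integral over [y], the terms
    coming from the first two endpoints are at most [C^m t^m] and [C t^m] at every
    [x].  The remaining term [H] has integral at most [m C^2 t^m * t]; where the
    convolution exceeds the stated level, [H] exceeds [m C^2 t^m]. *)
Lemma nnconv_weak (u : 'I_m -> R) (v eta : R) (g : 'I_m -> E -> R)
    (k : m.-tuple E -> R) (a : 'I_m -> R) (b C t : R) :
  (0 < m)%N ->
  0 < eta < v -> v + eta <= 1 -> (forall i, eta *+ 2 <= u i + v - 1) ->
  eta *+ (m.*2.+1) <= v - \sum_(i < m) (u i + v - 1) ->
  (forall i, measurable_fun setT (g i)) -> (forall i y, 0 <= g i y) ->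
  measurable_fun setT k -> (forall y, 0 <= k y) ->
  (forall i, 0 < a i) -> 0 < b -> 0 < C -> 0 < t ->
  (forall i, \int[mu]_y (two_power (u i) eta (g i y / a i))%:E <= (C * t)%:E)%E ->
  (\int[nu]_y (two_power v eta (k y / b))%:E <= (C * t ^+ m)%:E)%E ->
  (mu [set x | ((\prod_i a i) * b * (C ^+ m + C + m%:R * C ^+ 2) * t ^+ m)%R%:E <
     nnconv g k x] <= t%:E)%E.
Proof.
move=> m0 hv1 hv2 hu hs mg g0 mk k0 a0 b0 C0 t0 Ig Ik.
pose G i y := two_power (u i) eta (g i y / a i).
pose K y := two_power v eta (k y / b).
have G0 i y : 0 <= G i y by exact: two_power_ge0.
have K0 y : 0 <= K y by exact: two_power_ge0.
have mG i : measurable_fun setT (G i).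
  by apply: measurable_two_power; exact: measurable_funM.
have mK : measurable_fun setT K.
  by apply: measurable_two_power; exact: measurable_funM.
pose A := (\prod_i a i) * b.
have A0 : 0 < A by rewrite mulr_gt0// prodr_gt0.
have T0 : 0 < t ^+ m by rewrite exprn_gt0.
pose h (xy : E * m.-tuple E) := \sum_(j < m) G j (subtup xy.1 (tnth xy.2 j)) * K xy.2.
have mh : measurable_fun setT (EFin \o h).
  apply/measurable_EFinP; apply: measurable_sum => j.
  apply: measurable_funM; first exact: measurable_convolved.
  by apply: (measurableT_comp mK); exact: measurable_snd.
have h0 xy : (0 <= (EFin \o h) xy)%E.
  by rewrite lee_fin sumr_ge0// => j _; exact: mulr_ge0.
pose H x := (\int[nu]_y (h (x, y))%:E)%E.
have mH : measurable_fun setT H.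
  exact: (measurable_fun_fubini_tonelli_F (m2 := nu) _ mh h0).
have H0 x : (0 <= H x)%E by apply: integral_ge0 => y _; exact: (h0 (x, y)).
have mGK j : measurable_fun setT (fun xy : E * m.-tuple E =>
    (G j (subtup xy.1 (tnth xy.2 j)) * K xy.2)%:E).
  apply/measurable_EFinP/measurable_funM; first exact: measurable_convolved.
  by apply: (measurableT_comp mK); exact: measurable_snd.
have GK0 j xy : (0 <= (G j (subtup xy.1 (tnth xy.2 j)) * K xy.2)%:E)%E.
  by rewrite lee_fin mulr_ge0.
have IH : (\int[mu]_x H x <= (m%:R * C ^+ 2 * t ^+ m * t)%:E)%E.
  rewrite (eq_integral (fun x => \sum_(j < m)
      \int[nu]_y (G j (subtup x (tnth y j)) * K y)%:E)%E); last first.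
    move=> x _; rewrite /H /h -ge0_integral_sum//.
    - by apply: eq_integral => y _; rewrite sumEFin.
    - by move=> j; exact: (measurableT_comp (mGK j) (measurable_pair1 x)).
    - by move=> j y _; exact: (GK0 j (x, y)).
  rewrite ge0_integral_sum//; last 2 first.
  - move=> j; apply: (measurable_fun_fubini_tonelli_F (m2 := nu)
      (fun xy => (G j (subtup xy.1 (tnth xy.2 j)) * K xy.2)%:E)) => //.
  - by move=> j x _; apply: integral_ge0 => y _; exact: (GK0 j (x, y)).
  apply: (@le_trans _ _ (\sum_(j < m) ((C * t) * (C * t ^+ m))%:E)%E); last first.
    rewrite sumEFin lee_fin sumr_const card_ord -mulr_natl.
    by rewrite le_eqVlt; apply/orP; left; apply/eqP; ring.
  apply: lee_sum => j _; rewrite integral_convolved_mul// EFinM.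
  apply: lee_pmul; last 2 first.
  - exact: Ig.
  - exact: Ik.
  - by apply: integral_ge0 => y _; rewrite lee_fin.
  - by apply: integral_ge0 => y _; rewrite lee_fin.
have SH x : (nnconv g k x <= (A * (C ^+ m + C) * t ^+ m)%:E + A%:E * H x)%E.
  pose G1 y := (\prod_(i < m) G i (subtup x (tnth y i)))%:E.
  have mG1 : measurable_fun setT (G1 : m.-tuple E -> _).
    apply/measurable_EFinP; apply: measurable_prod => i _.
    exact: (measurableT_comp (measurable_convolved mG i) (measurable_pair1 x)).
  have G10 y : (0 <= G1 y)%E by rewrite lee_fin prodr_ge0.
  have mhx : measurable_fun setT (fun y => (h (x, y))%:E).
    exact: (measurableT_comp mh (measurable_pair1 x)).
  have mKE : measurable_fun setT (fun y => (K y)%:E) by exact/measurable_EFinP.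
  have KE0 y : (0 <= (K y)%:E)%E by rewrite lee_fin.
  have hx0 y : (0 <= (h (x, y))%:E)%E by exact: (h0 (x, y)).
  apply: (@le_trans _ _ (\int[nu]_y (A%:E * (G1 y + (K y)%:E + (h (x, y))%:E)))%E).
    apply: ge0_le_integral => //.
    - by move=> y _; rewrite lee_fin mulr_ge0// prodr_ge0.
    - apply/measurable_EFinP/measurable_funM => //; apply: measurable_prod => i _.
      exact: (measurableT_comp (measurable_convolved mg i) (measurable_pair1 x)).
    - by apply: measurable_funeM; do 2?apply: emeasurable_funD.
    move=> y _; rewrite -!EFinD -EFinM lee_fin.
    have -> : (\prod_(i < m) g i (subtup x (tnth y i))) * k y =
        A * ((\prod_(i < m) (g i (subtup x (tnth y i)) / a i)) * (k y / b)).
      rewrite /A prodf_div; field.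
      by rewrite ?gt_eqF ?prodr_gt0.
    rewrite ler_pM2l//; apply: two_power_mixing => //.
      by move=> i; rewrite divr_ge0// ltW.
    by rewrite divr_ge0// ltW.
  rewrite ge0_integralZl_EFin ?(ltW A0)//; last 2 first.
  - by move=> y _; rewrite !adde_ge0.
  - by do 2?apply: emeasurable_funD.
  rewrite ge0_integralD//; last 2 first.
  - by move=> y _; rewrite adde_ge0.
  - by apply: emeasurable_funD.
  rewrite ge0_integralD// -mulrA (EFinM A) muleDr//; last first.
    apply: ge0_adde_def; rewrite inE; last by apply: integral_ge0.
    by apply: adde_ge0; apply: integral_ge0.
  apply: leeD => //; apply: lee_wpmul2l; first by rewrite lee_fin ltW.
  rewrite mulrDl EFinD; apply: leeD => //.
  rewrite /G1 integral_prod_convolved// -exprMn.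
  have -> : ((C * t) ^+ m)%:E = (\prod_(i < m) (C * t)%:E)%E :> \bar R.
    by rewrite prodEFin prodr_const card_ord.
  suff : (0 <= \prod_(i < m) \int[mu]_y (G i y)%:E <= \prod_(i < m) (C * t)%:E)%E.
    by case/andP.
  elim/big_rec2 : _ => [|i y z _ /andP[z0 zy]]; first by rewrite lee01 lexx.
  have Gi0 : (0 <= \int[mu]_y (G i y)%:E)%E.
    by apply: integral_ge0 => w _; rewrite lee_fin.
  by rewrite mule_ge0//= lee_pmul//; exact: Ig.
set c := m%:R * C ^+ 2 * t ^+ m.
have c0 : 0 < c by rewrite !mulr_gt0 ?exprn_gt0 ?ltr0n.
have mHc : measurable [set x | (c%:E <= H x)%E].
  by rewrite -[X in measurable X]setTI; exact: emeasurable_fun_c_infty.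
have mS := measurable_nnconv mg g0 mk k0.
apply: (@le_trans _ _ (mu [set x | (c%:E <= H x)%E])).
  apply: le_measure; rewrite ?inE//.
    by rewrite -[X in measurable X]setTI; exact: emeasurable_fun_o_infty.
  move=> x /= Sx; rewrite leNgt; apply/negP => Hx.
  move: Sx; apply/negP; rewrite -leNgt; apply: le_trans (SH x) _.
  apply: (@le_trans _ _ ((A * (C ^+ m + C) * t ^+ m)%:E + A%:E * c%:E)%E).
    by rewrite leeD2l// lee_wpmul2l ?lee_fin ?(ltW A0)// ltW.
  rewrite -EFinM -EFinD lee_fin /c -/A le_eqVlt; apply/orP; left; apply/eqP; ring.
have := le_integral_abse mu measurableT mH c0.
rewrite setTI.
under [X in (_ * mu X)%E]eq_set do rewrite gee0_abs//.
under eq_integral do rewrite gee0_abs//.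
move=> /le_trans /(_ IH).
by rewrite (EFinM c t) lee_pmul2l ?lte_fin.
Qed.

End nonnegative_convolution.

(** * Lebesgue measurable functions and Borel functions *)

Section completion.
Context d (T : measurableType d) (R : realType).
Variable mu : {sigma_finite_measure set T -> \bar R}.
Let I : measurableType _ := caratheodory_type (mu^*)%mu.
Let cmu : {measure set I -> \bar R} := @completed_measure_extension d T R mu.
Local Open Scope ereal_scope.

Lemma completed_measurable (A : set T) : measurable A -> measurable (A : set I).
Proof. exact: caratheodory_measurable_mu_ext. Qed.

Lemma completedE (A : set T) : measurable A -> cmu A = mu A.
Proof. exact: measurable_mu_extE. Qed.

Lemma completed_measurable_fun d' (U : measurableType d') (h : T -> U) :
  measurable_fun setT h -> measurable_fun setT (h : I -> U).
Proof.
move=> mh _ B mB; rewrite setTI; apply: completed_measurable.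
by rewrite -[X in measurable X]setTI; exact: mh.
Qed.

Lemma ge0_integral_completed (h : T -> \bar R) : measurable_fun setT h ->
  (forall x, 0 <= h x) -> \int[cmu]_x h x = \int[mu]_x h x.
Proof.
move=> mh h0.
have mid : measurable_fun setT (idfun : I -> T).
  exact: (@completed_measurable_fun _ T (fun x => x) (@measurable_id _ _ _)).
rewrite -[LHS](ge0_integral_pushforward mid cmu (D := setT) measurableT mh); last first.
  by move=> x _; exact: h0.
apply: eq_measure_integral => // A mA _.
exact: completedE.
Qed.

Lemma outer_hull (X : set T) : (mu^*)%mu X < +oo ->
  exists G, [/\ measurable G, X `<=` G & mu G = (mu^*)%mu X].
Proof.
move=> Xoo; have X0 : 0 <= (mu^*)%mu X by exact: outer_measure_ge0.
have Xf : (mu^*)%mu X \is a fin_num by rewrite ge0_fin_numE.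
have /choice[F FP] : forall k : nat, exists F, [/\ measurable F, X `<=` F &
    mu F <= (mu^*)%mu X + (k.+1%:R^-1)%:E].
  move=> k; have k0 : (0 < k.+1%:R^-1 :> R)%R by rewrite invr_gt0.
  have [_ [A [mA XA] <-] Ak] := lb_ereal_inf_adherent k0 Xf.
  exists (\bigcup_i A i); split => //; first exact: bigcupT_measurable.
  apply: le_trans (ltW Ak).
  by apply: measure_sigma_subadditive => //; exact: bigcupT_measurable.
have mF k : measurable (F k) by case: (FP k).
have mG : measurable (\bigcap_k F k) by exact: bigcapT_measurable.
have XG : X `<=` \bigcap_k F k by move=> x Xx k _; case: (FP k) => _ + _; exact.
exists (\bigcap_k F k); split => //.
apply/eqP; rewrite eq_le; apply/andP; split; last first.
  by rewrite -(measurable_mu_extE _ mG); exact: le_outer_measure.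
apply/lee_addgt0Pr => e e0.
have [k ke] : exists k : nat, (k.+1%:R^-1 <= e)%R.
  exists (Num.bound e^-1); rewrite invf_ple ?posrE//.
  apply: ltW; apply: lt_le_trans (archi_boundP _) _; first by rewrite invr_ge0 ltW.
  by rewrite ler_nat.
apply: (@le_trans _ _ (mu (F k))).
  by apply: le_measure; rewrite ?inE//; exact: bigcap_inf.
by case: (FP k) => _ _ /le_trans; apply; rewrite leeD2l// lee_fin.
Qed.

(** On a set [S k] of finite measure, the hull [G] of [A] has the same outer measure
    as [A], and [A] is measurable, so that [G] minus [A] is null; its own hull is the
    exceptional set. *)
Lemma caratheodory_borel (A : set T) : measurable (A : set I) ->
  exists B N, [/\ measurable B, measurable N, mu N = 0 &
    forall x, ~ N x -> (A x <-> B x)].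
Proof.
move=> mA; have [S ST Sfin] := sigma_finiteT mu.
have mS k : measurable (S k) by case: (Sfin k).
have /choice[BN BNP] : forall k : nat, exists BN : set T * set T,
    [/\ measurable BN.1, measurable BN.2, mu BN.2 = 0 &
      forall x, ~ BN.2 x -> ((A `&` S k) x <-> BN.1 x)].
  move=> k.
  have mAS : measurable (A `&` S k : set I).
    by apply: measurableI => //; exact: completed_measurable.
  have ASoo : (mu^*)%mu (A `&` S k) < +oo.
    apply: le_lt_trans (le_outer_measure (mu^*)%mu _ _ (@subIsetr _ A (S k))) _.
    rewrite (_ : _ (S k) = mu (S k)); first by case: (Sfin k).
    exact: measurable_mu_extE.
  have [G [mG AG muG]] := outer_hull ASoo.
  have G0 : (mu^*)%mu (G `&` ~` (A `&` S k)) = 0.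
    have : (mu^*)%mu G = (mu^*)%mu (G `&` (A `&` S k)) +
      (mu^*)%mu (G `&` ~` (A `&` S k)) by exact: mAS G.
    have -> : (mu^*)%mu G = mu G by exact: measurable_mu_extE.
    rewrite (setIidr AG) muG.
    have Af : (mu^*)%mu (A `&` S k) \is a fin_num.
      by rewrite ge0_fin_numE//; exact: outer_measure_ge0.
    set a := (mu^*)%mu (A `&` S k) in Af *; set b := (mu^*)%mu _ => e.
    transitivity (a + b - a); first by rewrite addeAC subee// add0e.
    by rewrite -e subee.
  have [|N [mN GN muN]] := @outer_hull (G `&` ~` (A `&` S k)); first by rewrite G0.
  exists (G, N); split => //=; first by rewrite muN G0.
  move=> x Nx; split; first exact: AG.
  by move=> Gx; apply: contrapT => ASx; apply: Nx; apply: GN.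
exists (\bigcup_k (BN k).1), (\bigcup_k (BN k).2); split.
- by apply: bigcupT_measurable => k; case: (BNP k).
- by apply: bigcupT_measurable => k; case: (BNP k).
- apply/negligibleP; first by apply: bigcupT_measurable => k; case: (BNP k).
  by apply: negligible_bigcup => k; apply/negligibleP; case: (BNP k).
- move=> x Nx; split.
    move=> Ax; have [k _ Sk] : (\bigcup_k S k) x by rewrite -ST.
    exists k => //; case: (BNP k) => _ _ _ /(_ x) [] //.
      by move=> Nk; apply: Nx; exists k.
    by move=> + _; apply.
  move=> [k _ Bk]; case: (BNP k) => _ _ _ /(_ x) []//.
    by move=> Nk; apply: Nx; exists k.
  by move=> _ /(_ Bk)[].
Qed.

(** The sets [f > q] for rational [q] determine [f]; the exceptional sets of their
    Borel versions have a null union [N], and [f] is Borel once set to [0] on [N]. *)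
Lemma borel_version (f : I -> R) : measurable_fun setT f ->
  exists (g : T -> R) N, [/\ measurable_fun setT g, measurable N, mu N = 0 &
    forall x, ~ N x -> f x = g x].
Proof.
move=> mf; pose qk (k : nat) : R := ratr (odflt 0%R (unpickle k : option rat)).
have qkP (w : rat) : qk (pickle w) = ratr w by rewrite /qk pickleK.
have /choice[BN BNP] : forall k : nat, exists BN : set T * set T,
    [/\ measurable BN.1, measurable BN.2, mu BN.2 = 0 &
      forall x, ~ BN.2 x -> ((qk k < f x)%R <-> BN.1 x)].
  move=> k; have mA : measurable [set x : I | (qk k < f x)%R].
    have := mf measurableT _ (measurable_itv `]qk k, +oo[).
    by rewrite setTI preimage_itvoy.
  by have [B [N [mB mN N0 h]]] := caratheodory_borel mA; exists (B, N).
pose N := \bigcup_k (BN k).2.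
have mN : measurable N by apply: bigcupT_measurable => k; case: (BNP k).
have N0 : mu N = 0.
  apply/negligibleP => //.
  by apply: negligible_bigcup => k; apply/negligibleP; case: (BNP k).
(* off [N] this is [f], and [f > a] is the union of the [f > q] with [q > a] *)
pose g x := (f x * \1_(~` N) x)%R.
have gN x : ~ N x -> f x = g x.
  by move=> Nx; rewrite /g indicE mem_set// mulr1.
have g0 x : N x -> g x = 0%R.
  by move=> Nx; rewrite /g indicE memNset ?mulr0//; exact.
exists g, N; split => //.
apply: (measurability _ (RGenOInfty.measurableE R)).
move=> /= _ [_ [a ->]] <-; rewrite setTI preimage_itvoy.
rewrite (_ : [set x | _] = ((\bigcup_(k in [set k | (a < qk k)%R]) (BN k).1) `&` ~` N)
    `|` (N `&` [set _ | (a < 0)%R])); last first.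
  apply/seteqP; split=> x /=.
    have [Nx|Nx] := pselect (N x); first by rewrite g0// => a0; right.
    rewrite -gN// => /rat_in_itvoo[q]; rewrite in_itv/= => /andP[aq qf].
    left; split => //; exists (pickle q); rewrite /= ?qkP//.
    case: (BNP (pickle q)) => _ _ _ /(_ x) [].
      by move=> Nq; apply: Nx; exists (pickle q).
    by rewrite qkP => + _; apply.
  move=> [[[k /= ak Bk] Nx]|[Nx a0]]; last by rewrite g0.
  rewrite -gN//; case: (BNP k) => _ _ _ /(_ x) [].
    by move=> Nk; apply: Nx; exists k.
  by move=> _ /(_ Bk); exact: lt_trans.
apply: measurableU.
  apply: measurableI; last exact: measurableC.
  by apply: bigcup_measurable => k _; case: (BNP k).
apply: measurableI => //; have [a0|a0] := boolP (a < 0)%R.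
  by rewrite (_ : [set _ | _] = setT)//; apply/seteqP; split.
by rewrite (_ : [set _ | _] = set0)//; apply/seteqP; split.
Qed.

Lemma complex_borel_version (f : I -> R[i]) : cmeasurable f ->
  exists (g : T -> R[i]) N, [/\ cmeasurable g, measurable N, mu N = 0 &
    forall x, ~ N x -> f x = g x].
Proof.
move=> [/borel_version[g1 [N1 [mg1 mN1 N10 h1]]] /borel_version[g2 [N2 [mg2 mN2 N20 h2]]]].
exists (fun x => (g1 x +i* g2 x)%C), (N1 `|` N2); split => //.
- exact: measurableU.
- apply/negligibleP; first exact: measurableU.
  by apply: negligibleU; exact/negligibleP.
- move=> x /not_orP[n1 n2]; rewrite -h1// -h2//.
  by case: (f x).
Qed.

End completion.

Section completed_integral.
Context d (T : measurableType d) (R : realType).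
Variable mu : {sigma_finite_measure set T -> \bar R}.
Let I : measurableType _ := caratheodory_type (mu^*)%mu.
Let cmu : {measure set I -> \bar R} := @completed_measure_extension d T R mu.
Local Open Scope ereal_scope.

Lemma integral_completed (h : T -> \bar R) : measurable_fun setT h ->
  \int[cmu]_x h x = \int[mu]_x h x.
Proof.
move=> mh; rewrite integralE [RHS]integralE.
congr (_ - _).
- by apply: ge0_integral_completed => //; exact: measurable_funepos.
- by apply: ge0_integral_completed => //; exact: measurable_funeneg.
Qed.

(** [h] is measurable because the completed measure is complete. *)
Lemma integral_completed_ae (h : I -> \bar R) (h' : T -> \bar R) (N : set T) :
  measurable_fun setT h' -> measurable N -> mu N = 0 ->
  (forall x, ~ N x -> h x = h' x) -> \int[cmu]_x h x = \int[mu]_x h' x.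
Proof.
move=> mh' mN N0 hN; rewrite -integral_completed//.
have cN : measurable (N : set I) by exact: completed_measurable.
have cN0 : cmu N = 0 by rewrite completedE.
have mh'I : measurable_fun setT (h' : I -> \bar R) by exact: completed_measurable_fun.
have hae : ae_eq cmu setT (h' : I -> \bar R) h.
  exists N; split => //= x /= nh; apply: contrapT => Nx; apply: nh => _.
  by rewrite hN.
apply: ae_eq_integral => //; last exact: ae_eq_sym.
by apply: (ae_measurable_fun _ hae) => //; exact: measure_is_complete_caratheodory.
Qed.

End completed_integral.

(** * Complex-valued integrands *)

Lemma cmeasurableM (R : realType) d (T : measurableType d) (f g : T -> R[i]) :
  cmeasurable f -> cmeasurable g -> cmeasurable (fun x => f x * g x).
Proof.
move=> [fr fi] [gr gi]; split.
  rewrite (_ : (fun _ => _) = fun x => complex.Re (f x) * complex.Re (g x) -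
      complex.Im (f x) * complex.Im (g x)).
    by apply: measurable_funB; exact: measurable_funM.
  by apply/funext => x; case: (f x) => a b; case: (g x).
rewrite (_ : (fun _ => _) = fun x => complex.Re (f x) * complex.Im (g x) +
    complex.Im (f x) * complex.Re (g x)).
  by apply: measurable_funD; exact: measurable_funM.
by apply/funext => x; case: (f x) => a b; case: (g x).
Qed.

Lemma cmeasurable_prod (R : realType) d (T : measurableType d) m
    (f : 'I_m -> T -> R[i]) : (forall i, cmeasurable (f i)) ->
  cmeasurable (fun x => \prod_(i < m) f i x).
Proof.
elim: m f => [f _|m IH f mf].
  by split; under eq_fun do rewrite big_ord0; exact: measurable_cst.
rewrite (_ : (fun _ => _) =
    fun x => f ord0 x * \prod_(i < m) f (lift ord0 i) x).
  by apply: cmeasurableM => //; exact: IH.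
by apply/funext => x; rewrite big_ord_recl.
Qed.

Lemma cmeasurableT_comp (R : realType) d (T : measurableType d) d'
    (U : measurableType d') (f : U -> R[i]) (g : T -> U) :
  cmeasurable f -> measurable_fun setT g -> cmeasurable (fun x => f (g x)).
Proof.
by move=> [fr fi] mg; split; [exact: (measurableT_comp fr)|exact: (measurableT_comp fi)].
Qed.

Lemma cabsM (R : realType) (x y : R[i]) : cabs (x * y) = cabs x * cabs y.
Proof. exact: ComplexField.Normc.normcM. Qed.

Lemma cabs_prod (R : realType) m (f : 'I_m -> R[i]) :
  cabs (\prod_(i < m) f i) = \prod_(i < m) cabs (f i).
Proof.
elim/big_ind2 : _ => [|x x' y y' <- <-|//]; last exact: cabsM.
exact: ComplexField.Normc.normc1.
Qed.

Lemma normRe_le_cabs (R : realType) (z : R[i]) : `|complex.Re z| <= cabs z.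
Proof. by rewrite cabsE -sqrtr_sqr ler_wsqrtr// lerDl sqr_ge0. Qed.

Lemma normIm_le_cabs (R : realType) (z : R[i]) : `|complex.Im z| <= cabs z.
Proof. by rewrite cabsE -sqrtr_sqr ler_wsqrtr// lerDr sqr_ge0. Qed.

Lemma cabs_le (R : realType) (z : R[i]) :
  cabs z <= `|complex.Re z| + `|complex.Im z|.
Proof.
rewrite cabsE -[leRHS]ger0_norm ?addr_ge0// -sqrtr_sqr ler_wsqrtr//.
rewrite -[complex.Re z ^+ 2]real_normK ?num_real//.
rewrite -[complex.Im z ^+ 2]real_normK ?num_real// sqrrD.
have : 0 <= `|complex.Re z| * `|complex.Im z| by rewrite mulr_ge0.
lra.
Qed.

Section borel_convolution.
Context (R : realType) (n m : nat).
Let E := n.-tuple (measurableTypeR R).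
Local Notation mu := (borel_leb R n).
Local Notation nu := (borel_leb_pow R n m).
Variables (f : 'I_m -> E -> R[i]) (K : m.-tuple E -> R[i]).
Hypothesis mf : forall i, cmeasurable (f i).
Hypothesis mK : cmeasurable K.

Definition borel_integrand (x : E) (y : m.-tuple E) : R[i] :=
  (\prod_(i < m) f i (subtup x (tnth y i))) * K y.

Lemma cmeasurable_borel_integrand :
  cmeasurable (fun xy : E * m.-tuple E => borel_integrand xy.1 xy.2).
Proof.
apply: cmeasurableM; last by apply: cmeasurableT_comp.
apply: cmeasurable_prod => i; apply: cmeasurableT_comp => //.
apply: measurable_subtup; first exact: measurable_fst.
by apply: (measurableT_comp (measurable_tnth i)); exact: measurable_snd.
Qed.

Lemma cmeasurable_borel_integrand1 x : cmeasurable (borel_integrand x).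
Proof.
exact: (cmeasurableT_comp cmeasurable_borel_integrand (measurable_pair1 x)).
Qed.

Lemma nnconv_cabs (x : E) :
  nnconv (fun i y => cabs (f i y)) (fun y => cabs (K y)) x =
  (\int[nu]_y (cabs (borel_integrand x y))%:E)%E.
Proof. by apply: eq_integral => y _; rewrite /borel_integrand cabsM cabs_prod. Qed.

Lemma measurable_integral_param (h : E * m.-tuple E -> R) : measurable_fun setT h ->
  measurable_fun setT (fun x => \int[nu]_y h (x, y)).
Proof.
move=> mh; apply: (measurableT_comp (fine_measurable measurableT)).
under eq_fun do rewrite integralE.
have mE : measurable_fun setT (EFin \o h) by exact/measurable_EFinP.
have mp := measurable_funepos mE; have mn := measurable_funeneg mE.
apply: emeasurable_funB.
- apply: (eq_measurable_fun _ _
    (measurable_fun_fubini_tonelli_F (m2 := nu) _ mp (funepos_ge0 _))) => x _.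
  by apply: eq_integral => y _; rewrite !funeposE.
- apply: (eq_measurable_fun _ _
    (measurable_fun_fubini_tonelli_F (m2 := nu) _ mn (funeneg_ge0 _))) => x _.
  by apply: eq_integral => y _; rewrite !funenegE.
Qed.

End borel_convolution.

(** * Reduction of the convolution to Borel data *)

Section transfer.
Context (R : realType) (n m : nat).
Let E := n.-tuple (measurableTypeR R).
Local Notation mu := (borel_leb R n).
Local Notation nu := (borel_leb_pow R n m).

(** Changing [f_i] on a null set changes the integrand on a null set for every [x]:
    the set of the [y] with [x - y_i] in [N] is a box with one null side. *)
Lemma null_convolved (N : set E) (x : E) (i : 'I_m) : measurable N -> mu N = 0%E ->
  measurable [set y : m.-tuple E | N (subtup x (tnth y i))] /\
  nu [set y | N (subtup x (tnth y i))] = 0%E.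
Proof.
move=> mN N0.
have msub : measurable_fun setT (fun w : E => subtup x w) by exact: measurable_subtup.
pose A := [set w | N (subtup x w)].
have mA : measurable A by rewrite -[X in measurable X]setTI; exact: msub.
have A0 : mu A = 0%E.
  have intE (B : set E) : measurable B -> (\int[mu]_w (\1_B w)%:E)%E = mu B.
    by move=> mB; rewrite integral_indic// setIT.
  rewrite -(intE _ mA) -N0 -(intE _ mN).
  apply: (@ge0_integral_subtupr R n x (fun w => (\1_N w)%:E)) => //.
  by apply/measurable_EFinP; exact: measurable_indic.
have -> : [set y : m.-tuple E | N (subtup x (tnth y i))] =
    [set y | forall j, (if j == i then A else setT) (tnth y j)].
  apply/seteqP; split=> y /=.
    by move=> Ny j; case: eqP => [->|].
  by move=> /(_ i); rewrite eqxx.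
have mB j : measurable (if j == i then A else setT) by case: ifP.
split.
  rewrite (_ : [set _ | _] = \bigcap_(j in [set: 'I_m])
      ((@tnth _ E ^~ j) @^-1` (if j == i then A else setT))); last first.
    by apply/seteqP; split=> y /= h j; [move=> _|]; exact: h.
  apply: fin_bigcap_measurable => // j _; rewrite -[X in measurable X]setTI.
  exact: measurable_tnth.
by rewrite [LHS](tuple_measure_box mu mB) (bigD1 i)//= eqxx A0 mul0e.
Qed.

Variables (f : 'I_m -> Rn R n -> R[i]) (K : Rnm R n m -> R[i]).
Variables (f' : 'I_m -> E -> R[i]) (K' : m.-tuple E -> R[i]).
Variables (N : 'I_m -> set E) (M : set (m.-tuple E)).
Hypothesis mf' : forall i, cmeasurable (f' i).
Hypothesis mK' : cmeasurable K'.
Hypothesis mN : forall i, measurable (N i).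
Hypothesis N0 : forall i, mu (N i) = 0%E.
Hypothesis mM : measurable M.
Hypothesis M0 : nu M = 0%E.
Hypothesis ff' : forall i x, ~ N i x -> f i x = f' i x.
Hypothesis KK' : forall y, ~ M y -> K y = K' y.

Lemma conv_integrand_borel (x : E) : exists Z, [/\ measurable Z, nu Z = 0%E &
  forall y, ~ Z y -> conv_integrand f K x y = borel_integrand f' K' x y].
Proof.
pose Z := M `|` \bigcup_(i in [set: 'I_m]) [set y : m.-tuple E | N i (subtup x (tnth y i))].
have mU : measurable (\bigcup_(i in [set: 'I_m])
    [set y : m.-tuple E | N i (subtup x (tnth y i))]).
  by apply: fin_bigcup_measurable => // i _; case: (null_convolved x i (mN i) (N0 i)).
exists Z; split.
- exact: measurableU.
- apply/negligibleP; first exact: measurableU.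
  apply: negligibleU; first exact/negligibleP.
  rewrite (_ : bigcup _ _ = \big[setU/set0]_(i < m)
      [set y : m.-tuple E | N i (subtup x (tnth y i))]).
    apply: big_ind => [||i _]; [exact: negligible_set0|by move=> *; exact: negligibleU|].
    by apply/negligibleP; case: (null_convolved x i (mN i) (N0 i)).
  rewrite -bigcup_seq; apply/seteqP; split=> y /= [i _ Ni]; exists i => //=.
  exact: mem_index_enum.
- move=> y /not_orP[My Uy]; rewrite /conv_integrand /borel_integrand KK'//.
  congr (_ * _); apply: eq_bigr => i _; apply: ff' => Ni; apply: Uy.
  by exists i.
Qed.

Lemma abs_convergentE (x : E) : conv_defined f K x <->
  (nnconv (fun i y => cabs (f' i y)) (fun y => cabs (K' y)) x < +oo)%E.
Proof.
have [Z [mZ Z0 hZ]] := conv_integrand_borel x.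
rewrite /conv_defined /abs_convergent nnconv_cabs.
rewrite (integral_completed_ae
  (h' := fun y => (cabs (borel_integrand f' K' x y))%:E) _ mZ Z0)//.
  apply/measurable_EFinP; apply: measurable_cabs.
  exact: cmeasurable_borel_integrand1.
by move=> y Zy; rewrite hZ.
Qed.

Lemma cintegral_conv (x : E) : cintegral (leb_pow R n m) (conv_integrand f K x) =
  (\int[nu]_y complex.Re (borel_integrand f' K' x y) +i*
   \int[nu]_y complex.Im (borel_integrand f' K' x y))%C.
Proof.
have [Z [mZ Z0 hZ]] := conv_integrand_borel x.
have [mr mi] := cmeasurable_borel_integrand1 mf' mK' x.
rewrite /cintegral /Rintegral; congr (fine _ +i* fine _)%C.
- apply: (integral_completed_ae _ mZ Z0); first exact/measurable_EFinP.
  by move=> y Zy; rewrite hZ.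
- apply: (integral_completed_ae _ mZ Z0); first exact/measurable_EFinP.
  by move=> y Zy; rewrite hZ.
Qed.

Local Notation majorant :=
  (nnconv (fun i y => cabs (f' i y)) (fun y => cabs (K' y))).

(** The modulus of the convolution is at most twice the convolution of the moduli: the
    real and the imaginary part of the integral are bounded separately. *)
Lemma cabs_conv_gt (l : R) (x : E) : 0 <= l ->
  2 * l < cabs (multilinear_conv f K x) -> (l%:E < majorant x)%E.
Proof.
move=> l0; rewrite /multilinear_conv; case: asboolP => [fx|_]; last first.
  by rewrite /cabs ComplexField.Normc.normc0 ltNge mulr_ge0.
rewrite cintegral_conv => hl; rewrite ltNge; apply/negP => xl.
have [mr mi] := cmeasurable_borel_integrand1 mf' mK' x.
have mc := measurable_cabs (cmeasurable_borel_integrand1 mf' mK' x).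
have bound (h : m.-tuple E -> R) : measurable_fun setT h ->
    (forall y, `|h y| <= cabs (borel_integrand f' K' x y)) ->
    `|\int[nu]_y h y| <= l.
  move=> mh hc.
  have : (`|\int[nu]_y (h y)%:E| <= l%:E)%E.
    apply: le_trans xl; rewrite nnconv_cabs.
    apply: le_trans (le_abse_integral nu measurableT _) _; first exact/measurable_EFinP.
    apply: ge0_le_integral => //.
    - by apply: measurableT_comp => //; exact/measurable_EFinP.
    - exact/measurable_EFinP.
    - by move=> y _; rewrite lee_fin.
  by rewrite /Rintegral; case: (\int[nu]_y (h y)%:E)%E => [z|_|_]//=;
    rewrite ?lee_fin// normr0.
move: hl; apply/negP; rewrite -leNgt.
apply: le_trans (cabs_le _) _; rewrite mulr2n mulrDl mul1r /=.
apply: lerD; apply: bound => // y; [exact: normRe_le_cabs|exact: normIm_le_cabs].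
Qed.

Lemma cmeasurable_conv : cmeasurable (multilinear_conv f K).
Proof.
pose h := fun x : E => if (majorant x < +oo)%E then
  (\int[nu]_y complex.Re (borel_integrand f' K' x y) +i*
   \int[nu]_y complex.Im (borel_integrand f' K' x y))%C else 0.
have -> : multilinear_conv f K = h.
  apply/funext => x; rewrite /multilinear_conv /h; case: asboolP.
    by move=> /abs_convergentE ->; exact: cintegral_conv.
  by move=> nx; rewrite ifN//; apply/negP => /abs_convergentE.
have [mr mi] := cmeasurable_borel_integrand mf' mK'.
have mc : measurable_fun setT (fun x : E => (majorant x < +oo)%E).
  apply: measurable_fun_lte => //.
  rewrite (_ : majorant =
    fun x => \int[nu]_y (cabs (borel_integrand f' K' x y))%:E)%E; last first.
    by apply/funext => x; rewrite nnconv_cabs.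
  apply: (measurable_fun_fubini_tonelli_F (m2 := nu)
    (fun xy : E * m.-tuple E => (cabs (borel_integrand f' K' xy.1 xy.2))%:E)).
    by apply/measurable_EFinP; apply: measurable_cabs; exact: cmeasurable_borel_integrand.
  by move=> xy; rewrite lee_fin cabs_ge0.
split.
  apply: (@completed_measurable_fun _ E R mu _ _ (fun x => complex.Re (h x))).
  rewrite (_ : (fun _ => _) = fun x => if (majorant x < +oo)%E then
      \int[nu]_y complex.Re (borel_integrand f' K' x y) else 0); last first.
    by apply/funext => x; rewrite /h; case: ifP.
  apply: measurable_fun_ifT => //.
  exact: (measurable_integral_param
    (h := fun xy => complex.Re (borel_integrand f' K' xy.1 xy.2))).
apply: (@completed_measurable_fun _ E R mu _ _ (fun x => complex.Im (h x))).
rewrite (_ : (fun _ => _) = fun x => if (majorant x < +oo)%E then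
    \int[nu]_y complex.Im (borel_integrand f' K' x y) else 0); last first.
  by apply/funext => x; rewrite /h; case: ifP.
apply: measurable_fun_ifT => //.
exact: (measurable_integral_param
    (h := fun xy => complex.Im (borel_integrand f' K' xy.1 xy.2))).
Qed.

End transfer.

(** * From bounds at each scale to Lorentz norms *)

Lemma finite_pos_lb (R : realType) (I : finType) (c : I -> R) :
  (forall i, 0 < c i) -> exists2 e, 0 < e & forall i, e <= c i.
Proof.
move=> c0; exists (\big[Num.min/1]_i c i).
  by apply: lt_bigmin => [|i _]; rewrite ?c0.
by move=> i; exact: bigmin_le_cond.
Qed.

(** The estimates are proved for positive bounds [N i] on the norms.  If some norm
    vanishes, its bound can be sent to [0] with the other ones fixed. *)
Lemma prod_limit (R : realType) (I : finType) (nn : I -> R) (D : R) (y : \bar R) :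
  0 <= D -> (forall i, 0 <= nn i) ->
  (forall N : I -> R, (forall i, 0 < N i) -> (forall i, nn i <= N i) ->
    (y <= (D * \prod_i N i)%:E)%E) ->
  (y <= (D * \prod_i nn i)%:E)%E.
Proof.
move=> D0 n0 h.
have [nP|] := pselect (forall i, 0 < nn i); first exact: h.
move=> /existsNP[j /negP]; rewrite -leNgt => nj.
have {nj}nj : nn j = 0 by apply/eqP; rewrite eq_le nj n0.
rewrite (bigD1 j)//= nj mul0r mulr0; apply/lee_addgt0Pr => e e0; rewrite add0e.
(* any bounds will do for the other factors; the [j]-th one absorbs them *)
pose P := \prod_(i | i != j) (nn i + 1).
have P0 : 0 < P by apply: prodr_gt0 => i _; rewrite ltr_wpDl.
have DP : 0 < D * P + 1 by rewrite ltr_wpDl// mulr_ge0// ltW.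
apply: le_trans (h (fun i => if i == j then e / (D * P + 1) else nn i + 1) _ _) _.
- by move=> i; case: ifP => _; rewrite ?divr_gt0// ltr_wpDl.
- move=> i; case: eqP => [->|_]; last by rewrite lerDl.
  by rewrite nj divr_ge0 ?ltW.
rewrite lee_fin (bigD1 j)//= eqxx.
rewrite (eq_bigr (fun i => nn i + 1)); last by move=> i /negPf ->.
rewrite -/P mulrCA -mulrA ler_piMr ?(ltW e0)// mulrC ler_pdivrMr// mul1r.
by rewrite lerDl.
Qed.

Lemma fine_inve_ge0 (R : realType) (q : \bar R) : (0 < q)%E -> 0 <= fine q^-1.
Proof.
case: q => [q|_|//]; last by rewrite invey.
by rewrite lte_fin => q0; rewrite inver gt_eqF//= invr_ge0 ltW.
Qed.

Lemma inve_EFin (R : realType) (q : \bar R) : (0 < q)%E -> (q^-1 = (fine q^-1)%:E)%E.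
Proof.
case: q => [q|_|//]; last by rewrite invey.
by rewrite lte_fin => q0; rewrite inver gt_eqF.
Qed.

(** The two definitions of the norm are treated alike: for [q = +oo] the exponents of
    [Z t] and of [C] are both [0]. *)
Lemma lorentz_norm_le (R : realType) d (T : measurableType d)
    (mu : {measure set T -> \bar R}) (f : T -> R[i]) (p : R) (q : \bar R)
    (B C : R) (Z : measurableTypeR R -> R) :
  (0 < q)%E -> 0 <= B -> 0 <= C -> measurable_fun setT Z ->
  (forall t, 0 < t -> 0 <= Z t) ->
  (\int[lebesgue_measure]_(t in `]0%R, +oo[) (Z t / t)%:E <= C%:E)%E ->
  (forall t, 0 < t ->
    (rearrangement mu f t <= (B * Z t `^ fine q^-1 * t `^ (- p^-1))%:E)%E) ->
  (lorentz_norm mu p q f <= (B * C `^ fine q^-1)%:E)%E.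
Proof.
move=> q0 B0 C0 mZ Z0 IZ hf.
have tp (t : R) : 0 < t -> ((t `^ p^-1)%:E * rearrangement mu f t <=
    (B * Z t `^ fine q^-1)%:E)%E.
  move=> t0; apply: (@le_trans _ _ ((t `^ p^-1)%:E *
      (B * Z t `^ fine q^-1 * t `^ (- p^-1))%:E)%E).
    by rewrite lee_wpmul2l ?lee_fin ?powR_ge0// hf.
  rewrite -EFinM mulrCA -powRD; last by rewrite (gt_eqF t0) implybT.
  by rewrite subrr powRr0 mulr1.
case: q q0 tp hf => [q|_|//]; last first.
  rewrite invey/= => tp _; apply: ge_ereal_sup => _ [t t0 <-].
  by apply: le_trans (tp t t0) _; rewrite !powRr0.
rewrite lte_fin => q0; rewrite inver gt_eqF//= => tp _.
set r := rearrangement mu f in tp *.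
have r0 t : (0 <= r t)%E by exact: rearrangement_ge0.
have mV := @measurable_inv_itv0y R.
have mZt : measurable_fun (`]0%R, +oo[%classic : set (measurableTypeR R))
    (fun t : measurableTypeR R => (Z t / t)%:E).
  by apply/measurable_EFinP; apply: measurable_funM => //; exact: measurable_funTS.
set J := (\int[_]_(_ in _) _)%E.
have J0 : (0 <= J)%E.
  apply: integral_ge0 => t /itv0y_gt0 t0.
  by rewrite mule_ge0 ?poweR_ge0// lee_fin invr_ge0 ltW.
have JC : (J <= (B `^ q * C)%:E)%E.
  apply: (@le_trans _ _ (\int[lebesgue_measure]_(t in `]0%R, +oo[)
      ((B `^ q)%:E * (Z t / t)%:E))%E).
    apply: ge0_le_integral => //.
    - by move=> t /itv0y_gt0 t0; rewrite mule_ge0 ?poweR_ge0// lee_fin invr_ge0 ltW.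
    - apply: emeasurable_funM; last exact/measurable_EFinP.
      apply: measurable_funTS; apply: (measurableT_comp (measurable_poweR q)).
      apply: emeasurable_funM; last exact: measurable_rearrangement.
      by apply/measurable_EFinP; exact: measurable_powR.
    - exact: measurable_funeM.
    - move=> t /itv0y_gt0 t0; rewrite (EFinM (Z t)) muleA; apply: lee_wpmul2r.
        by rewrite lee_fin invr_ge0 ltW.
      rewrite -EFinM; apply: (@le_trans _ _ ((B * Z t `^ q^-1)%:E `^ q)%E).
        apply: gt0_ler_poweR; rewrite ?(ltW q0)// ?in_itv/= ?leey ?andbT ?tp//.
          by rewrite mule_ge0// lee_fin powR_ge0.
        by rewrite lee_fin mulr_ge0// powR_ge0.
      rewrite poweR_EFin lee_fin powRM ?powR_ge0// -powRrM mulVf ?gt_eqF//.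
      by rewrite powRr1 ?Z0.
  rewrite ge0_integralZl_EFin//; last 2 first.
  - by move=> t /itv0y_gt0 t0; rewrite lee_fin divr_ge0 ?(ltW t0) ?Z0.
  - exact: powR_ge0.
  by rewrite EFinM lee_wpmul2l// lee_fin powR_ge0.
apply: (@le_trans _ _ ((B `^ q * C)%:E `^ q^-1)%E).
  apply: gt0_ler_poweR; rewrite ?invr_ge0 ?(ltW q0)// in_itv/= leey andbT//.
  by rewrite lee_fin mulr_ge0// powR_ge0.
by rewrite poweR_EFin lee_fin powRM ?powR_ge0// -powRrM mulfV ?gt_eqF// powRr1.
Qed.

(** This replaces the inequality of Hoelder: each [X i] and [Y] is at most their
    sum. *)
Lemma prod_powR_le (R : realType) m (X : 'I_m -> R) (Y : R) (th : 'I_m -> R) (ta : R) :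
  (forall i, 0 <= X i) -> 0 <= Y -> (forall i, 0 <= th i) -> 0 <= ta ->
  (\prod_(i < m) X i `^ th i) * Y `^ ta <=
  (\sum_(i < m) X i + Y) `^ (\sum_(i < m) th i + ta).
Proof.
move=> X0 Y0 th0 ta0.
have S0 : 0 <= \sum_(i < m) X i by exact: sumr_ge0.
have Z0 : 0 <= \sum_(i < m) X i + Y by rewrite addr_ge0.
rewrite powRD_nneg ?sumr_ge0// powR_sum//.
apply: ler_pM; rewrite ?powR_ge0//.
- by apply: prodr_ge0 => i _; exact: powR_ge0.
- apply: ler_prod => i _; rewrite powR_ge0/= ge0_ler_powR ?nnegrE//.
  rewrite (bigD1 i)//= -addrA lerDl addr_ge0// sumr_ge0//.
- by rewrite ge0_ler_powR ?nnegrE// lerDr.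
Qed.

(** * The estimate *)

(** Here [u i = 1/p_i], [v = 1/r] and [w = 1/p]: the strict inequalities between the
    exponents leave room for a uniform perturbation. *)
Lemma exponent_margin (R : realType) (m : nat) (u : 'I_m -> R) (v w : R) :
  0 < v < 1 -> 0 < w -> (forall i, 1 - v < u i) ->
  w = v - \sum_(i < m) (u i + v - 1) ->
  exists eta, [/\ 0 < eta < v, v + eta <= 1,
    forall i, eta *+ 2 <= u i + v - 1, forall i, eta < u i &
    eta *+ (m.*2.+1) <= v - \sum_(i < m) (u i + v - 1)].
Proof.
move=> /andP[v0 v1] w0 hu wE.
have [e e0 ee] : exists2 e, 0 < e & forall i, e <= u i + v - 1.
  by apply: finite_pos_lb => i; have := hu i; lra.
pose M := Num.min (Num.min (1 - v) (v / 2)) (Num.min (e / 2) (w / (m.*2.+1)%:R)).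
have M0 : 0 < M by rewrite !lt_min !divr_gt0// subr_gt0 v1.
have M1 : M <= 1 - v by rewrite /M !ge_min lexx.
have M2 : M <= v / 2 by rewrite /M !ge_min lexx orbT.
have M3 : M <= e / 2 by rewrite /M !ge_min lexx !orbT.
have M4 : M <= w / (m.*2.+1)%:R by rewrite /M !ge_min lexx !orbT.
have M5 i : M *+ 2 <= u i + v - 1 by rewrite mulr2n; have := ee i; lra.
exists M; split => //.
- by rewrite M0/=; lra.
- by lra.
- by move=> i; have := M5 i; rewrite mulr2n; lra.
- by rewrite -wE -mulr_natr -ler_pdivlMr.
Qed.

Section main_estimate.
Context (R : realType) (n m : nat) (ps : 'I_m -> R) (r p : R).
Context (qs : 'I_m -> \bar R) (s q : \bar R).
Hypothesis m_gt0 : (0 < m)%N.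
Hypothesis ps_gt1 : forall i, 1 < ps i.
Hypothesis r_gt1 : 1 < r.
Hypothesis p_gt1 : 1 < p.
Hypothesis scaling : m%:R + p^-1 = \sum_(i < m) (ps i)^-1 + m%:R / r.
Hypothesis p_r : p^-1 < r^-1.
Hypothesis r_ps : forall i, 1 - r^-1 < (ps i)^-1.
Hypothesis qs_gt0 : forall i, (0 < qs i)%E.
Hypothesis s_gt0 : (0 < s)%E.
Hypothesis q_gt0 : (0 < q)%E.
Hypothesis q_def : (q^-1 = \sum_(i < m) (qs i)^-1 + s^-1)%E.

(** The scaling condition matches the powers of [t] that the profiles contribute. *)
Lemma scaling_powR (t : R) : 0 < t ->
  (\prod_(i < m) t `^ (- (ps i)^-1)) * (t ^+ m) `^ (- r^-1) * t ^+ m = t `^ (- p^-1).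
Proof.
move=> t0.
have -> : \prod_(i < m) t `^ (- (ps i)^-1) = t `^ (- \sum_(i < m) (ps i)^-1).
  rewrite powRN powR_sum => [|i]; last first.
    by rewrite invr_ge0 (le_trans ler01)// ltW.
  by rewrite -prodfV; apply: eq_bigr => i _; rewrite powRN.
rewrite -[t ^+ m]powR_mulrn ?(ltW t0)// -powRrM -!powRD ?(gt_eqF t0) ?implybT//.
by congr (_ `^ _); move: scaling; rewrite -[m%:R / r]/(m%:R * r^-1); lra.
Qed.

Lemma fine_q_def : fine q^-1 = \sum_(i < m) fine (qs i)^-1 + fine s^-1.
Proof.
rewrite q_def (inve_EFin s_gt0) (eq_bigr (fun i => (fine (qs i)^-1)%:E)).
  by rewrite sumEFin -EFinD.
by move=> i _; rewrite -inve_EFin.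
Qed.

(** At every scale [t], [nnconv_weak] applies to the Borel versions of the data divided
    by the constants [a i] and [b] of their profiles, and bounds the rearrangement of
    the convolution at [t] by [2 * lam t]; [lorentz_norm_le] integrates this bound.
    Letting [t] tend to [0], the convolution of the moduli is infinite on a null set
    only. *)
Lemma conv_estimate : exists2 D : R, 0 < D &
  forall (f : 'I_m -> Rn R n -> R[i]) (K : Rnm R n m -> R[i])
    (N : 'I_m -> R) (M : R),
    (forall i, cmeasurable (f i)) -> cmeasurable K ->
    (forall i, 0 < N i) -> 0 < M ->
    (forall i, lorentz_norm (leb R n) (ps i) (qs i) (f i) <= (N i)%:E)%E ->
    (lorentz_norm (leb_pow R n m) r s K <= M%:E)%E ->
  [/\ {ae leb R n, forall x, conv_defined f K x},
      cmeasurable (multilinear_conv f K) &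
      (lorentz_norm (leb R n) p q (multilinear_conv f K) <=
       (D * (\prod_(i < m) N i) * M)%:E)%E].
Proof.
have p0 : 0 < p by exact: lt_trans p_gt1.
have r0 : 0 < r by exact: lt_trans r_gt1.
have ps0 i : 0 < ps i by exact: lt_trans (ps_gt1 i).
have v01 : 0 < r^-1 < 1 by rewrite invr_gt0 r0/= invf_lt1.
have w0 : 0 < r^-1 - p^-1 by rewrite subr_gt0.
have wE : r^-1 - p^-1 = r^-1 - \sum_(i < m) ((ps i)^-1 + r^-1 - 1).
  rewrite big_split/= big_split/= !sumr_const !card_ord.
  by move: scaling; rewrite mulr_natl mulNrn; lra.
have [eta [hv1 hv2 hu hu' hs]] := exponent_margin v01 w0 r_ps wE.
have /andP[eta0 _] := hv1.
have hu1 i : 0 < eta < (ps i)^-1 by rewrite eta0 hu'.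
pose prof i := cid2 (lorentz_profile (ps0 i) (hu1 i) (ltnSn 0) (qs_gt0 i)).
pose Cf i := s2val (prof i).
have Cf0 i : 0 < Cf i := s2valP (prof i).
have CfP i := s2valP' (prof i).
have [Ck Ck0 CkP] := lorentz_profile r0 hv1 m_gt0 s_gt0.
pose C := \sum_(i < m) Cf i + Ck.
have SC0 : 0 <= \sum_(i < m) Cf i by apply: sumr_ge0 => i _; rewrite ltW.
have C0 : 0 < C by rewrite ltr_wpDl.
have CfC i : Cf i <= C.
  by rewrite /C (bigD1 i)//= -addrA lerDl addr_ge0 ?(ltW Ck0)// sumr_ge0// => j _; rewrite ltW.
have CkC : Ck <= C by rewrite /C lerDr.
pose c := C ^+ m + C + m%:R * C ^+ 2.
have c0 : 0 < c.
  apply: addr_gt0; first by apply: addr_gt0 => //; exact: exprn_gt0.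
  by apply: mulr_gt0; [rewrite ltr0n|exact: exprn_gt0].
pose D0 := 2 * c * (\prod_(i < m) Cf i) * Ck.
have D00 : 0 < D0 by rewrite !mulr_gt0// prodr_gt0.
exists (D0 * C `^ fine q^-1); first by rewrite mulr_gt0// powR_gt0.
move=> f K N M mf mK N0 M0 fN KM.
pose prX i := cid (CfP i _ _ _ _ _ (mf i) (N0 i) (fN i)).
pose X i := sval (prX i); have XP i := svalP (prX i).
have [Y [mY Y0 IY hY]] := CkP _ _ _ _ _ mK M0 KM.
have mX i : measurable_fun setT (X i) by case: (XP i).
have X0 i t : 0 < t -> 0 < X i t by case: (XP i) => _ + _ _; exact.
have IX i : (\int[lebesgue_measure]_(t in `]0%R, +oo[) (X i t / t)%:E <= (Cf i)%:E)%E.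
  by case: (XP i).
pose E := n.-tuple (measurableTypeR R).
have /choice[fZ fZP] : forall i, exists fZ : (E -> R[i]) * set E,
    [/\ cmeasurable fZ.1, measurable fZ.2, borel_leb R n fZ.2 = 0%E &
      forall x, ~ fZ.2 x -> f i x = fZ.1 x].
  move=> i; have [g [Z [h1 h2 h3 h4]]] := complex_borel_version (mf i).
  by exists (g, Z).
pose f' i := (fZ i).1; pose Z i := (fZ i).2.
have mf' i : cmeasurable (f' i) by case: (fZP i).
have mZ i : measurable (Z i) by case: (fZP i).
have Z0 i : borel_leb R n (Z i) = 0%E by case: (fZP i).
have ff' i x : ~ Z i x -> f i x = f' i x by case: (fZP i) => _ _ _; exact.
have [K' [ZK [mK' mZK ZK0 KK']]] := complex_borel_version mK.
pose g i y := cabs (f' i y); pose k y := cabs (K' y).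
have mg i : measurable_fun setT (g i) by exact: measurable_cabs.
have mk : measurable_fun setT k by exact: measurable_cabs.
have g0 i y : 0 <= g i y by exact: cabs_ge0.
have k0 y : 0 <= k y by exact: cabs_ge0.
pose P t := (\prod_(i < m) X i t `^ fine (qs i)^-1) * Y t `^ fine s^-1.
pose lam t := c * (\prod_(i < m) Cf i) * Ck * (\prod_(i < m) N i) * M * P t * t `^ (- p^-1).
have P0 t : 0 < t -> 0 < P t.
  move=> t0; rewrite mulr_gt0 ?powR_gt0 ?Y0// prodr_gt0// => i _.
  by rewrite powR_gt0 ?X0.
have lam0 t : 0 < t -> 0 < lam t.
  move=> t0; apply: mulr_gt0; last exact: powR_gt0.
  apply: mulr_gt0; last exact: P0.
  by rewrite !mulr_gt0// prodr_gt0.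
have mnn : measurable_fun setT (nnconv g k) by exact: measurable_nnconv.
(* [lam t] is the level of [nnconv_weak] for [a i] and [b], by [scaling_powR] *)
have weak t : 0 < t -> (borel_leb R n [set x | ((lam t)%:E < nnconv g k x)%E] <= t%:E)%E.
  move=> t0.
  pose a i := Cf i * N i * X i t `^ (fine (qs i)^-1) * t `^ (- (ps i)^-1).
  pose b := Ck * M * Y t `^ fine s^-1 * (t ^+ m) `^ (- r^-1).
  have a0 i : 0 < a i by rewrite !mulr_gt0 ?powR_gt0 ?X0.
  have b0 : 0 < b by rewrite !mulr_gt0 ?powR_gt0 ?Y0 ?exprn_gt0.
  have -> : lam t = (\prod_i a i) * b * c * t ^+ m.
    rewrite /a !big_split/= /b /lam /P -(scaling_powR t0); ring.
  apply: (nnconv_weak (u := fun i => (ps i)^-1) (v := r^-1) (eta := eta)) => //.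
  - move=> i; apply: (@le_trans _ _ (Cf i * t)%:E); last first.
      by rewrite lee_fin ler_wpM2r ?(ltW t0).
    case: (XP i) => _ _ _ /(_ t t0); rewrite !expr1; apply: le_trans.
    rewrite le_eqVlt; apply/orP; left; apply/eqP/esym.
    apply: (integral_completed_ae (N := Z i)) => //.
      by apply/measurable_EFinP; apply: measurable_two_power; exact: measurable_funM.
    by move=> x Zx; rewrite ff'.
  - apply: (@le_trans _ _ (Ck * t ^+ m)%:E); last first.
      by rewrite lee_fin ler_wpM2r// exprn_ge0// ltW.
    apply: le_trans (hY t t0).
    rewrite le_eqVlt; apply/orP; left; apply/eqP/esym.
    apply: (integral_completed_ae (N := ZK)) => //.
      by apply/measurable_EFinP; apply: measurable_two_power; exact: measurable_funM.
    by move=> x Zx; rewrite KK'.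
have mgt (l : R) : measurable [set x | (l%:E < nnconv g k x)%E].
  by rewrite -[X in measurable X]setTI; exact: emeasurable_fun_o_infty.
have mT : cmeasurable (multilinear_conv f K).
  exact: (cmeasurable_conv mf' mK' mZ Z0 mZK ZK0 ff' KK').
split => //.
- pose U : set E := [set x | (nnconv g k x = +oo)%E].
  have mU : measurable U.
    rewrite (_ : U = setT `&` (nnconv g k @^-1` [set +oo%E])); last by rewrite setTI.
    by apply: mnn => //; exact: emeasurable_set1.
  exists U; split.
  + exact: completed_measurable.
  + rewrite [LHS]completedE//; apply/eqP; rewrite eq_le measure_ge0 andbT.
    apply/lee_addgt0Pr => t t0; rewrite add0e; apply: le_trans (weak t t0).
    by apply: le_measure; rewrite ?inE// => x /= ->; rewrite ltry.
  + move=> x /= nd; rewrite /U/=; apply/eqP; rewrite -leye_eq leNgt; apply/negP.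
    by move=> /(abs_convergentE mf' mK' mZ Z0 mZK ZK0 ff' KK').
have rear t : 0 < t -> (rearrangement (leb R n) (multilinear_conv f K) t <=
    (2 * lam t)%:E)%E.
  move=> t0; apply: rearrangement_le; first by rewrite mulr_ge0// ltW ?lam0.
  apply: le_trans (weak t t0).
  rewrite -[leRHS]completedE//; apply: le_measure; rewrite ?inE.
  + have := measurable_cabs mT measurableT (measurable_itv `]2 * lam t, +oo[).
    by rewrite setTI preimage_itvoy.
  + exact: completed_measurable.
  move=> x /= hx; apply: (cabs_conv_gt mf' mK' mZ Z0 mZK ZK0 ff' KK') hx.
  by rewrite ltW// lam0.
have PN0 : 0 < \prod_(i < m) N i by exact: prodr_gt0.
have B0 : 0 < D0 * (\prod_(i < m) N i) * M.
  by apply: mulr_gt0 => //; exact: mulr_gt0.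
rewrite [X in (_ <= X%:E)%E](_ : _ =
  D0 * (\prod_(i < m) N i) * M * C `^ fine q^-1); last by ring.
apply: (lorentz_norm_le (Z := fun t => \sum_(i < m) X i t + Y t)) => //.
- exact: ltW.
- exact: ltW.
- by apply: measurable_funD => //; exact: measurable_sum.
- move=> t t0; rewrite addr_ge0 ?(ltW (Y0 _ t0))//.
  by apply: sumr_ge0 => i _; rewrite ltW// X0.
- have mV := @measurable_inv_itv0y R.
  have mdiv (h : measurableTypeR R -> R) : measurable_fun setT h ->
      measurable_fun (`]0%R, +oo[%classic : set (measurableTypeR R))
        (fun t : measurableTypeR R => (h t / t)%:E).
    by move=> mh; apply/measurable_EFinP/measurable_funM => //; exact: measurable_funTS.
  rewrite (eq_integral (fun t => (\sum_(i < m) (X i t / t)%:E + (Y t / t)%:E)%E)); last first.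
    by move=> t _; rewrite mulrDl mulr_suml EFinD sumEFin.
  rewrite ge0_integralD//; last 4 first.
  + move=> t /itv0y_gt0 t0; apply: sume_ge0 => i _.
    by rewrite lee_fin divr_ge0 ?(ltW t0)// ltW// X0.
  + by apply: emeasurable_sum => i; exact: mdiv.
  + by move=> t /itv0y_gt0 t0; rewrite lee_fin divr_ge0 ?(ltW t0)// ltW// Y0.
  + exact: mdiv.
  rewrite ge0_integral_sum//; last 2 first.
  + by move=> i; exact: mdiv.
  + by move=> i t /itv0y_gt0 t0; rewrite lee_fin divr_ge0 ?(ltW t0)// ltW// X0.
  by rewrite /C EFinD -sumEFin; apply: leeD => //; exact: lee_sum.
- move=> t t0; apply: le_trans (rear t t0) _.
  rewrite lee_fin (_ : 2 * lam t =
    D0 * (\prod_(i < m) N i) * M * P t * t `^ (- p^-1)); last first.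
    by rewrite /lam /D0; ring.
  rewrite ler_wpM2r ?powR_ge0// ler_wpM2l ?(ltW B0)//.
  rewrite fine_q_def; apply: prod_powR_le.
  + by move=> i; rewrite ltW// X0.
  + by rewrite ltW// Y0.
  + by move=> i; exact: fine_inve_ge0.
  + exact: fine_inve_ge0.
Qed.
End main_estimate.

Unset Implicit Arguments.

Theorem theorem2p2 (R : realType) (n m : nat) (ps : 'I_m -> R) (r p : R)
    (qs : 'I_m -> \bar R) (s q : \bar R)
    (n_gt0 : (0 < n)%N) (m_gt0 : (0 < m)%N)
    (ps_gt1 : forall i, 1 < ps i) (r_gt1 : 1 < r) (p_gt1 : 1 < p)
    (scaling : m%:R + p^-1 = \sum_(i < m) (ps i)^-1 + m%:R / r)
    (p_r : p^-1 < r^-1) (r_ps : forall i, 1 - r^-1 < (ps i)^-1)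
    (qs_gt0 : forall i, (0 < qs i)%E) (s_gt0 : (0 < s)%E) (q_gt0 : (0 < q)%E)
    (q_def : (q^-1 = \sum_(i < m) (qs i)^-1 + s^-1)%E) :
  exists2 C : R, 0 < C &
    forall (f : 'I_m -> Rn R n -> R[i]) (K : Rnm R n m -> R[i]),
      (forall i, lorentz_space (leb R n) (ps i) (qs i) (f i)) ->
      lorentz_space (leb_pow R n m) r s K ->
      [/\ {ae leb R n, forall x, conv_defined f K x},
          cmeasurable (multilinear_conv f K) &
          (lorentz_norm (leb R n) p q (multilinear_conv f K) <=
           C%:E * (\prod_(i < m) lorentz_norm (leb R n) (ps i) (qs i) (f i)) *
           lorentz_norm (leb_pow R n m) r s K)%E].
Proof.
have [D D0 hD] := conv_estimate n m_gt0 ps_gt1 r_gt1 p_gt1 scaling p_r r_ps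
  qs_gt0 s_gt0 q_gt0 q_def.
exists D; first exact: D0.
move=> f K fL [mK KL].
have mf i : cmeasurable (f i) by case: (fL i).
have nf i : (lorentz_norm (leb R n) (ps i) (qs i) (f i) < +oo)%E by case: (fL i).
have normE d (T : measurableType d) (mu : {measure set T -> \bar R}) a b (h : T -> R[i]) :
    (0 < b)%E -> (lorentz_norm mu a b h < +oo)%E ->
    exists2 c : R, 0 <= c & lorentz_norm mu a b h = c%:E.
  move=> b0 hoo.
  have h0 : (0 <= lorentz_norm mu a b h)%E.
    case: b b0 {hoo} => [b _|_|//]; first exact: poweR_ge0.
    apply: le_trans (ereal_sup_ubound _); last by exists 1 => //=.
    by rewrite mule_ge0 ?rearrangement_ge0// lee_fin powR_ge0.
  exists (fine (lorentz_norm mu a b h)); first exact: fine_ge0.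
  by rewrite fineK// ge0_fin_numE.
have /choice[nn nnP] : forall i, exists c : R, 0 <= c /\
    lorentz_norm (leb R n) (ps i) (qs i) (f i) = c%:E.
  by move=> i; have [c c0 cE] := normE _ _ _ _ _ _ (qs_gt0 i) (nf i); exists c.
have [k k0 kE] := normE _ _ _ _ _ _ s_gt0 KL.
have nn0 i : 0 <= nn i by case: (nnP i).
have nnE i : lorentz_norm (leb R n) (ps i) (qs i) (f i) = (nn i)%:E by case: (nnP i).
have [h1 h2 _] : [/\ {ae leb R n, forall x, conv_defined f K x},
      cmeasurable (multilinear_conv f K) &
      (lorentz_norm (leb R n) p q (multilinear_conv f K) <=
       (D * (\prod_(i < m) (nn i + 1)) * (k + 1))%:E)%E].
  apply: hD => //.
  - by move=> i; rewrite ltr_wpDl.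
  - by rewrite ltr_wpDl.
  - by move=> i; rewrite nnE lee_fin lerDl.
  - by rewrite kE lee_fin lerDl.
split => //.
rewrite kE (eq_bigr (fun i => (nn i)%:E)); last by move=> i _; exact: nnE.
rewrite prodEFin -!EFinM.
have -> : D * (\prod_(i < m) nn i) * k =
    D * (\prod_(i < m) nn i) * \prod_(i < 1) k by rewrite big_ord1.
apply: (prod_limit (nn := fun _ : 'I_1 => k)) => //.
  by rewrite mulr_ge0 ?(ltW D0)// prodr_ge0.
move=> M M0 kM; rewrite big_ord1 mulrAC.
apply: prod_limit => //; first by rewrite mulr_ge0 ?(ltW D0)// ltW.
move=> N N0 nN; rewrite mulrAC.
have [||//] := hD f K N (M ord0) mf mK N0 (M0 ord0).
- by move=> i; rewrite nnE lee_fin.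
- by rewrite kE lee_fin.
Qed.
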